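(* Let $\Gamma=\mathrm{Cone}^{n-k-2}\left(\bigcup_{i=1}^kv_i\right)$ be the $(n-k-2)$-fold iterated cone over the discrete set of $k$ vertices $v_1,\ldots,v_k$. The graph associahedron toric variety $\chi(\mathcal{P}\Gamma)$ which corresponds to $\Gamma$ can be mapped by a birational morphism to a variety in the orbit space $G_{n,2}/T^n$.
   Context: For a graph $\Gamma$ on $m+1$ vertices the graph associahedron $\mathcal{P}\Gamma$ is the $m$-dimensional convex polytope constructed by truncating the $m$-simplex based on the connected subgraphs of $\Gamma$; the toric variety $\chi(\mathcal{P}\Gamma)$ is obtained by blowing up the projective space along the coordinate subspaces which correspond to the connected subgraphs of $\Gamma$, and $\mathcal{P}\Gamma$ is its polytope. The cone over a graph adds one new vertex joined to all existing vertices; thus $\Gamma$ has $n-2$ vertices. $G_{n,2}$ is the Grassmannian of $2$-dimensional subspaces of $\mathbb{C}^n$ with Plücker coordinates $P^I$, $|I|=2$, and the canonical actions of $(\mathbb{C}^* )^n$ and of the compact torus $T^n$. The moment map $\mu(L)=\frac{1}{\sum_I|P^I(L)|^2}\sum_I|P^I(L)|^2\Lambda_I$ ($\Lambda_I$ the indicator vector of $I$) has image $\Delta_{n,2}=\{x\in[0,1]^n : \sum x_i=2\}$ and induces $\hat\mu:G_{n,2}/T^n\to\Delta_{n,2}$. Strata: $W_\sigma=\{L : P^I(L)\ne 0\iff I\in\sigma\}\neq\emptyset$; $P_\sigma=\mathrm{conv}(\Lambda_I, I\in\sigma)$, $\mu(W_\sigma)=\mathring{P}_\sigma$; $F_\sigma=W_\sigma/(\mathbb{C}^*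 )^n$. Chambers: $C_\omega=\bigcap_{\sigma\in\omega}\mathring{P}_\sigma\ne\emptyset$ with $C_\omega\cap\mathring{P}_\sigma=\emptyset$ for $\sigma\notin\omega$. The varieties in the orbit space meant here are the spaces of parameters $F_\omega=\bigcup_{\sigma\in\omega}F_\sigma\cong\hat\mu^{-1}(x)\subset G_{n,2}/T^n$, $x\in C_\omega\subset\mathring{\Delta}_{n,2}$, with the variety structure of the categorical quotient of $\bigcup_{\sigma\in\omega}W_\sigma$ by $(\mathbb{C}^* )^n$, identified with the GIT quotient of $(\mathbb{C}P^1)^n$ by the diagonal $PGL_2(\mathbb{C})$ with fractional linearisation in $C_\omega$. *)

(* Defs.v *)
From mathcomp Require Import all_boot all_order all_algebra.
From mathcomp Require Import boolp classical_sets reals complex.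

Set Implicit Arguments.
Unset Strict Implicit.
Unset Printing Implicit Defensive.
Import Order.TTheory GRing.Theory Num.Theory.

Local Open Scope classical_set_scope.
Local Open Scope ring_scope.

#[local] Obligation Tactic := idtac.

(* Classical varieties over a field K are handled as spaces with functions:   *)
(* a topology together with a sheaf of K-valued functions.  A function regular*)
(* on U is a total function of which only the values on U matter.             *)
Record space (K : fieldType) : Type := Space {
  pt :> Type;
  zopen : set pt -> Prop;
  regular : set pt -> (pt -> K) -> Prop;
  zopenT : zopen setT;
  zopenI : forall U V, zopen U -> zopen V -> zopen (U `&` V);
  zopen_bigcup : forall S : set (set pt),
    S `<=` zopen -> zopen (\bigcup_(U in S) U);
  regular_open : forall U f, regular U f -> zopen U;
  regular_ext : forall U f g, {in U, f =1 g} -> regular U f -> regular U g;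
  regular_restrict : forall U V f,
    zopen V -> V `<=` U -> regular U f -> regular V f;
  regular_glue : forall U f, zopen U ->
    (forall x, U x -> exists V, [/\ V x, V `<=` U & regular V f]) ->
    regular U f;
  regular_cst : forall U c, zopen U -> regular U (fun=> c);
  regularD : forall U f g,
    regular U f -> regular U g -> regular U (fun x => f x + g x);
  regularM : forall U f g,
    regular U f -> regular U g -> regular U (fun x => f x * g x);
  regular_unit : forall U f, regular U f -> zopen (U `&` [set x | f x != 0]);
  regularV : forall U f,
    regular U f -> regular (U `&` [set x | f x != 0]) (fun x => (f x)^-1) }.

Section Constructions.
Variable K : fieldType.

(* The polynomial functions on K^I; the index set I may be infinite. *)
Inductive polyfun (I : Type) : ((I -> K) -> K) -> Prop :=
| polyfun_cst c : polyfun (fun=> c)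
| polyfun_coord i : polyfun (fun x => x i)
| polyfunD p q : polyfun p -> polyfun q -> polyfun (fun x => p x + q x)
| polyfunM p q : polyfun p -> polyfun q -> polyfun (fun x => p x * q x).

Section AffineSpace.
Variable I : Type.

Definition aff_open (U : set (I -> K)) : Prop :=
  forall x, U x ->
    exists2 q, polyfun q & q x != 0 /\ (forall y, q y != 0 -> U y).

Definition aff_regular (U : set (I -> K)) (f : (I -> K) -> K) : Prop :=
  aff_open U /\
  forall x, U x -> exists p q, [/\ polyfun p, polyfun q, q x != 0 &
    forall y, U y -> q y != 0 -> f y = p y / q y].

Lemma aff_regular_unit U f :
  aff_regular U f -> aff_open (U `&` [set x | f x != 0]).
Proof.
move=> [oU rf] x [Ux /= fx].
have [p [q [pp pq qx e]]] := rf x Ux; have [h ph [hx hU]] := oU x Ux.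
have px : p x != 0 by apply: contraNneq fx => p0; rewrite e// p0 mul0r.
exists (fun y => p y * q y * h y).
  by apply: polyfunM => //; exact: polyfunM.
split=> [|y]; first by rewrite !mulf_neq0.
rewrite !mulf_eq0 !negb_or => /andP[/andP[py qy] hy].
have Uy := hU y hy; split=> //=.
by rewrite e// mulf_neq0// invr_neq0.
Qed.

Program Definition affine_space : space K :=
  @Space K (I -> K) aff_open aff_regular
    _ _ _ _ _ _ _ _ _ _ _ _.
Next Obligation.
by move=> x _; exists (fun=> 1); [exact: polyfun_cst | rewrite oner_neq0].
Qed.
Next Obligation.
move=> U V oU oV x [Ux Vx].
have [p pp [px pU]] := oU x Ux; have [q pq [qx qV]] := oV x Vx.
exists (fun x => p x * q x); first exact: polyfunM.
split=> [|y]; first by rewrite mulf_neq0.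
by rewrite mulf_eq0 negb_or => /andP[py qy]; split; [exact: pU | exact: qV].
Qed.
Next Obligation.
move=> S oS x [U SU Ux]; have [q pq [qx qU]] := oS U SU x Ux.
by exists q => //; split=> // y qy; exists U => //; exact: qU.
Qed.
Next Obligation. by move=> U f []. Qed.
Next Obligation.
move=> U f g fg [oU rf]; split=> // x Ux.
have [p [q [pp pq qx e]]] := rf x Ux; exists p, q; split=> // y Uy qy.
by rewrite -fg ?inE//; exact: e.
Qed.
Next Obligation.
move=> U V f oV VU [oU rf]; split=> // x Vx.
have [p [q [pp pq qx e]]] := rf x (VU _ Vx); exists p, q; split=> // y Vy.
by apply: e; exact: VU.
Qed.
Next Obligation.
move=> U f oU loc; split=> // x Ux; have [V [Vx VU [oV rf]]] := loc x Ux.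
have [p [q [pp pq qx e]]] := rf x Vx; have [h ph [hx hV]] := oV x Vx.
exists (fun y => p y * h y), (fun y => q y * h y); split.
- exact: polyfunM.
- exact: polyfunM.
- by rewrite mulf_neq0.
move=> y Uy; rewrite mulf_eq0 negb_or => /andP[qy hy].
rewrite e//; last exact: hV.
by rewrite -mulf_div divff// mulr1.
Qed.
Next Obligation.
move=> U c oU; split=> // x Ux; exists (fun=> c), (fun=> 1).
split; rewrite ?oner_neq0//; [exact: polyfun_cst|exact: polyfun_cst|].
by move=> y _ _; rewrite divr1.
Qed.
Next Obligation.
move=> U f g [oU rf] [_ rg]; split=> // x Ux.
have [p [q [pp pq qx e]]] := rf x Ux.
have [p' [q' [pp' pq' qx' e']]] := rg x Ux.
exists (fun y => p y * q' y + p' y * q y), (fun y => q y * q' y); split.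
- by apply: polyfunD; exact: polyfunM.
- exact: polyfunM.
- by rewrite mulf_neq0.
move=> y Uy; rewrite mulf_eq0 negb_or => /andP[qy qy'].
by rewrite e// e'// addf_div.
Qed.
Next Obligation.
move=> U f g [oU rf] [_ rg]; split=> // x Ux.
have [p [q [pp pq qx e]]] := rf x Ux.
have [p' [q' [pp' pq' qx' e']]] := rg x Ux.
exists (fun y => p y * p' y), (fun y => q y * q' y); split.
- exact: polyfunM.
- exact: polyfunM.
- by rewrite mulf_neq0.
move=> y Uy; rewrite mulf_eq0 negb_or => /andP[qy qy'].
by rewrite e// e'// mulf_div.
Qed.
Next Obligation. exact: aff_regular_unit. Qed.
Next Obligation.
move=> U f rf; split; first exact: aff_regular_unit.
case: rf => oU rf x [Ux /= fx]; have [p [q [pp pq qx e]]] := rf x Ux.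
have px : p x != 0 by apply: contraNneq fx => p0; rewrite e// p0 mul0r.
exists (fun y => q y * q y), (fun y => p y * q y); split.
- exact: polyfunM.
- exact: polyfunM.
- by rewrite mulf_neq0.
move=> y [Uy /= _]; rewrite mulf_eq0 negb_or => /andP[py qy].
by rewrite e// invf_div -mulf_div divff// mulr1.
Qed.

End AffineSpace.

Section Subspace.
Variables (X : space K) (S : set X).

Definition sub_pt : Type := {x : X | S x}.

Definition sub_open (U : set sub_pt) : Prop :=
  exists2 V, zopen V & U = sval @^-1` V.

Definition sub_regular (U : set sub_pt) (f : sub_pt -> K) : Prop :=
  sub_open U /\
  forall x, U x -> exists V g, [/\ V (sval x), regular V g &
    forall y, U y -> V (sval y) -> f y = g (sval y)].

Lemma sub_regular_unit U f :
  sub_regular U f -> sub_open (U `&` [set x | f x != 0]).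
Proof.
move=> [[W oW UW] rf].
pose T : set (set X) := [set V | zopen V /\
  forall y : sub_pt, V (sval y) -> U y /\ f y != 0].
exists (\bigcup_(V in T) V); first by apply: zopen_bigcup => V [].
apply/seteqP; split=> [x [Ux /= fx]|x [V [oV h] Vx]]; last exact: h.
have [V [g [Vx rg e]]] := rf x Ux.
exists (W `&` (V `&` [set z | g z != 0])).
  split; first exact: zopenI oW (regular_unit rg).
  move=> y [Wy [Vy /= gy]]; have Uy : U y by rewrite UW.
  by rewrite (e y Uy Vy).
have Wx : W (sval x) by move: Ux; rewrite UW.
by split=> //; split=> //=; rewrite -e.
Qed.

(* The structure induced on an arbitrary subset S of X: regular functions are *)
(* those that locally extend to regular functions on open subsets of X.       *)
Program Definition subspace : space K :=
  @Space K sub_pt sub_open sub_regular _ _ _ _ _ _ _ _ _ _ _ _.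
Next Obligation. by exists setT => //; exact: zopenT. Qed.
Next Obligation.
by move=> _ _ [U oU ->] [V oV ->]; exists (U `&` V) => //; exact: zopenI.
Qed.
Next Obligation.
move=> F oF; pose T : set (set X) := [set V | zopen V /\ F (sval @^-1` V)].
exists (\bigcup_(V in T) V); first by apply: zopen_bigcup => V [].
apply/seteqP; split=> [x [U FU Ux]|x [V [oV FV] Vx]]; last first.
  by exists (sval @^-1` V).
have [V oV UV] := oF U FU; exists V; first by split=> //; rewrite -UV.
by move: Ux; rewrite UV.
Qed.
Next Obligation. by move=> U f []. Qed.
Next Obligation.
move=> U f g fg [oU rf]; split=> // x Ux.
have [V [h [Vx rh e]]] := rf x Ux; exists V, h; split=> // y Uy Vy.
by rewrite -fg ?inE//; exact: e.
Qed.
Next Obligation.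
move=> U V f oV VU [oU rf]; split=> // x Vx.
have [W [h [Wx rh e]]] := rf x (VU _ Vx); exists W, h; split=> // y Vy.
by apply: e; exact: VU.
Qed.
Next Obligation.
move=> U f oU loc; split=> // x Ux; have [V [Vx VU [[W oW VW] rf]]] := loc x Ux.
have [Z [h [Zx rh e]]] := rf x Vx; exists (W `&` Z), h; split.
- by split=> //; move: Vx; rewrite VW.
- exact: regular_restrict (zopenI oW (regular_open rh)) (@subIsetr _ _ _) rh.
- by move=> y Uy [Wy Zy]; apply: e => //; rewrite VW.
Qed.
Next Obligation.
move=> U c oU; split=> // x Ux; exists setT, (fun=> c).
by split=> //; exact: regular_cst (zopenT X).
Qed.
Next Obligation.
move=> U f g [oU rf] [_ rg]; split=> // x Ux.
have [V [h [Vx rh e]]] := rf x Ux; have [V' [h' [Vx' rh' e']]] := rg x Ux.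
exists (V `&` V'), (fun z => h z + h' z); split=> //.
  have oVV := zopenI (regular_open rh) (regular_open rh').
  apply: regularD.
  + exact: regular_restrict oVV (@subIsetl _ _ _) rh.
  + exact: regular_restrict oVV (@subIsetr _ _ _) rh'.
by move=> y Uy [Vy Vy']; rewrite e// e'.
Qed.
Next Obligation.
move=> U f g [oU rf] [_ rg]; split=> // x Ux.
have [V [h [Vx rh e]]] := rf x Ux; have [V' [h' [Vx' rh' e']]] := rg x Ux.
exists (V `&` V'), (fun z => h z * h' z); split=> //.
  have oVV := zopenI (regular_open rh) (regular_open rh').
  apply: regularM.
  + exact: regular_restrict oVV (@subIsetl _ _ _) rh.
  + exact: regular_restrict oVV (@subIsetr _ _ _) rh'.
by move=> y Uy [Vy Vy']; rewrite e// e'.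
Qed.
Next Obligation. exact: sub_regular_unit. Qed.
Next Obligation.
move=> U f rUf; split; first exact: sub_regular_unit.
case: rUf => oU rf x [Ux /= fx]; have [V [h [Vx rh e]]] := rf x Ux.
exists (V `&` [set z | h z != 0]), (fun z => (h z)^-1); split.
- by split=> //=; rewrite -e.
- exact: regularV.
- by move=> y [Uy _] [Vy _]; rewrite e.
Qed.

End Subspace.

Section Coproduct.
Variables (J : Type) (X : J -> space K).

Definition coprod_pt : Type := {j : J & X j}.

Definition slice (j : J) (U : set coprod_pt) : set (X j) :=
  [set x | U (existT _ j x)].
Arguments slice : clear implicits.

Program Definition coproduct : space K :=
  @Space K coprod_pt (fun U => forall j, zopen (slice j U))
    (fun U f => forall j, regular (slice j U) (fun x => f (existT _ j x)))
    _ _ _ _ _ _ _ _ _ _ _ _.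
Next Obligation. by move=> j; exact: zopenT. Qed.
Next Obligation. by move=> U V oU oV j; apply: zopenI; [exact: oU|exact: oV]. Qed.
Next Obligation.
move=> F oF j.
have -> : slice j (\bigcup_(U in F) U) = \bigcup_(W in slice j @` F) W.
  apply/seteqP; split=> [x [U FU Ux]|x [_ [U FU <-] Ux]]; last by exists U.
  by exists (slice j U) => //; exists U.
by apply: zopen_bigcup => _ [U FU <-]; exact: oF.
Qed.
Next Obligation. by move=> U f rf j; exact: regular_open (rf j). Qed.
Next Obligation.
move=> U f g fg rf j; apply: regular_ext (rf j) => x; rewrite inE => Ux.
by apply: fg; rewrite inE.
Qed.
Next Obligation.
move=> U V f oV VU rf j; apply: regular_restrict (oV j) _ (rf j) => x.
exact: VU.
Qed.
Next Obligation.
move=> U f oU loc j; apply: regular_glue (oU j) _ => x Ux.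
have [V [Vx VU rf]] := loc _ Ux; exists (slice j V); split=> // y.
exact: VU.
Qed.
Next Obligation. by move=> U c oU j; exact: regular_cst (oU j). Qed.
Next Obligation. by move=> U f g rf rg j; exact: regularD (rf j) (rg j). Qed.
Next Obligation. by move=> U f g rf rg j; exact: regularM (rf j) (rg j). Qed.
Next Obligation. by move=> U f rf j; exact: regular_unit (rf j). Qed.
Next Obligation. by move=> U f rf j; exact: regularV (rf j). Qed.

End Coproduct.

Section Quotient.
Variables (X : space K) (E : X -> X -> Prop).

Definition quot_pt : Type := {A : set X | exists x, A = E x}.

Definition proj (x : X) : quot_pt := exist _ (E x : set X) (ex_intro _ x erefl).

(* The set of classes of the (equivalence) relation E with the final          *)
(* structure; quotient_universal says that this is the categorical quotient.  *)
Program Definition quotient : space K :=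
  @Space K quot_pt (fun U => zopen (proj @^-1` U))
    (fun U f => regular (proj @^-1` U) (f \o proj)) _ _ _ _ _ _ _ _ _ _ _ _.
Next Obligation. exact: zopenT. Qed.
Next Obligation. by move=> U V oU oV; exact: zopenI. Qed.
Next Obligation.
move=> F oF.
have -> : proj @^-1` (\bigcup_(U in F) U) =
    \bigcup_(W in (fun U => proj @^-1` U) @` F) W.
  apply/seteqP; split=> [x [U FU Ux]|x [_ [U FU <-] Ux]]; last by exists U.
  by exists (proj @^-1` U) => //; exists U.
by apply: zopen_bigcup => _ [U FU <-]; exact: oF.
Qed.
Next Obligation. by move=> U f; exact: regular_open. Qed.
Next Obligation.
move=> U f g fg; apply: regular_ext => x; rewrite inE => Ux /=.
by apply: fg; rewrite inE.
Qed.
Next Obligation.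
by move=> U V f oV VU; apply: regular_restrict => // x; exact: VU.
Qed.
Next Obligation.
move=> U f oU loc; apply: regular_glue => // x Ux.
have [V [Vx VU rf]] := loc _ Ux; exists (proj @^-1` V); split=> // y.
exact: VU.
Qed.
Next Obligation. by move=> U c oU; exact: regular_cst. Qed.
Next Obligation. by move=> U f g rf rg; exact: regularD rf rg. Qed.
Next Obligation. by move=> U f g rf rg; exact: regularM rf rg. Qed.
Next Obligation. by move=> U f rf; exact: regular_unit rf. Qed.
Next Obligation. by move=> U f rf; exact: regularV rf. Qed.

End Quotient.

Definition morphism (X Y : space K) (f : X -> Y) : Prop :=
  (forall U, zopen U -> zopen (f @^-1` U)) /\
  (forall U g, regular U g -> regular (f @^-1` U) (g \o f)).

Lemma quotient_universal (X Z : space K) (E : X -> X -> Prop) (f : X -> Z) :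
  (forall x, E x x) -> morphism f -> (forall x y, E x y -> f x = f y) ->
  exists! h : quotient E -> Z, morphism h /\ h \o @proj X E = f.
Proof.
move=> Exx [fo fr] fE.
pose h (A : quotient E) : Z := f (projT1 (cid (svalP A))).
have hf x : h (@proj X E x) = f x.
  rewrite /h; case: cid => y /= Exy; apply/esym/fE.
  by rewrite Exy; exact: Exx.
have hfE : h \o @proj X E = f by apply/funext.
exists h; split=> [|h' [_ h'f]].
  split=> //; split=> [U oU|U g rg].
    by change (zopen ((h \o @proj X E) @^-1` U)); rewrite hfE; exact: fo.
  change (regular ((h \o @proj X E) @^-1` U) (g \o (h \o @proj X E))).
  by rewrite hfE; exact: fr.
apply/funext => -[A [x Ax]]; subst A.
change (h (@proj X E x) = h' (@proj X E x)).
by rewrite hf -h'f.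
Qed.

Definition isomorphism (X Y : space K) (f : X -> Y) : Prop :=
  morphism f /\ exists g : Y -> X, [/\ morphism g, cancel f g & cancel g f].

Definition isomorphic (X Y : space K) : Prop :=
  exists f : X -> Y, isomorphism f.

Definition dense_open (X : space K) (U : set X) : Prop :=
  zopen U /\ forall V, zopen V -> V !=set0 -> (U `&` V) !=set0.

Definition birational_morphism (X Y : space K) (f : X -> Y) : Prop :=
  morphism f /\
  exists (U : set X) (V : set Y), [/\ dense_open U, dense_open V &
    exists2 h : subspace U -> subspace V,
      isomorphism h & forall x, sval (h x) = f (sval x)].

Definition affine (X : space K) : Prop :=
  exists (N : nat) (F : set (('I_N -> K) -> K)), F `<=` @polyfun 'I_N /\
    isomorphic X
      (@subspace (affine_space 'I_N) [set x | forall p, F p -> p x = 0]).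

Definition irreducible (X : space K) : Prop :=
  (exists x : X, True) /\
  forall U V : set X, zopen U -> zopen V -> U !=set0 -> V !=set0 ->
    (U `&` V) !=set0.

(* Equalizers are closed. *)
Definition separated (X : space K) : Prop :=
  forall (Z : space K) (f g : Z -> X), morphism f -> morphism g ->
    zopen [set z | f z <> g z].

Definition variety (X : space K) : Prop :=
  [/\ irreducible X, separated X &
    exists (m : nat) (U : 'I_m -> set X), (forall x, exists i, U i x) /\
      (forall i, zopen (U i) /\ affine (subspace (U i)))].

End Constructions.

Section Convexity.
Variables (R : realType) (V : finType).
Implicit Types (S : set {ffun V -> R}) (x y : {ffun V -> R}).

Definition affine_hull S : set {ffun V -> R} :=
  [set x | exists (m : nat) (c : 'I_m -> R) (p : 'I_m -> {ffun V -> R}),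
    [/\ forall i, S (p i), \sum_i c i = 1 & x = [ffun v => \sum_i c i * p i v]]].

Definition convex_hull S : set {ffun V -> R} :=
  [set x | exists (m : nat) (c : 'I_m -> R) (p : 'I_m -> {ffun V -> R}),
    [/\ forall i, S (p i), forall i, 0 <= c i, \sum_i c i = 1 &
        x = [ffun v => \sum_i c i * p i v]]].

Definition relative_interior S : set {ffun V -> R} :=
  [set x | S x /\ exists2 e : R, 0 < e &
    forall y, affine_hull S y -> (forall i, `|y i - x i| < e) -> S y].

End Convexity.

Section ToricVariety.
Variables (R : realType) (V : finType) (P : set {ffun V -> R}).

(* The lattice points of the tangent cone of the polytope P at x, that is, of *)
(* the dual of the cone of the inner normal fan of P attached to the face     *)
(* having x in its relative interior.  When P is not full-dimensional these   *)
(* points only span the lattice of integral vectors parallel to P.            *)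
Definition tangent_semigroup (x : {ffun V -> R}) : set {ffun V -> int} :=
  [set a | exists2 e : R, 0 < e & P [ffun i => x i + e * (a i)%:~R]].

Definition semigroup_index (x : {ffun V -> R}) : Type :=
  {a : {ffun V -> int} | tangent_semigroup x a}.

Definition monoid_hom (x : {ffun V -> R}) :
    set (affine_space R[i] (semigroup_index x)) :=
  [set g | (forall a, sval a = 0 -> g a = 1) /\
    (forall a b c, sval c = sval a + sval b -> g c = g a * g b)].

(* The closed points of Spec C[S] are the monoid morphisms from S to the      *)
(* multiplicative monoid of C.                                                *)
Definition toric_chart (x : {ffun V -> R}) : space R[i] :=
  subspace (@monoid_hom x).

Definition toric_charts : space R[i] :=
  coproduct (fun x : {x | P x} => toric_chart (sval x)).

(* The charts of two faces are glued along the chart of the smallest face     *)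
(* containing both, which has the midpoint of x and y in its relative         *)
(* interior; the corresponding cone is the intersection of the two cones.     *)
Definition toric_glue (p q : toric_charts) : Prop :=
  let: existT x g := p in let: existT y h := q in
  exists k : toric_chart [ffun i => (sval x i + sval y i) / 2],
    (forall a b, sval a = sval b -> sval g a = sval k b) /\
    (forall a b, sval a = sval b -> sval h a = sval k b).

(* The toric variety of the inner normal fan of the rational polytope P.      *)
Definition toric_variety : space R[i] := quotient toric_glue.

End ToricVariety.

Record graph : Type := Graph {
  vertex :> finType;
  edge : rel vertex;
  edge_sym : symmetric edge;
  edge_irr : irreflexive edge }.

Program Definition discrete_graph (k : nat) : graph :=
  @Graph 'I_k (fun _ _ => false) _ _.
Next Obligation. by []. Qed.
Next Obligation. by []. Qed.

(* The apex is None. *)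
Definition cone_edge (G : graph) (x y : option G) : bool :=
  match x, y with
  | Some u, Some v => edge u v
  | None, None => false
  | _, _ => true
  end.

Program Definition cone (G : graph) : graph :=
  @Graph (option G) (@cone_edge G) _ _.
Next Obligation. by move=> G [x|] [y|] //=; exact: edge_sym. Qed.
Next Obligation. by move=> G [x|] //=; exact: edge_irr. Qed.

Section GraphAssociahedron.
Variables (R : realType) (G : graph).

Definition tube (t : {set G}) : bool :=
  (0 < #|t| < #|G|)%N &&
  [forall x in t, forall y in t, connect [rel u v in t | edge u v] x y].

(* Heights of the truncating hyperplanes in Devadoss' realization: singletons *)
(* are the facets of the simplex and a tube t with at least two elements      *)
(* truncates the face on which the coordinates in t vanish.                   *)
Definition truncation_height (m : nat) : R :=
  if (m <= 1)%N then 0 else 3 ^+ (m - 2).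

Definition simplex : set {ffun G -> R} :=
  [set x | (forall i, 0 <= x i) /\ \sum_i x i = truncation_height #|G|].

Definition graph_associahedron : set {ffun G -> R} :=
  simplex `&` [set x | forall t : {set G}, tube t ->
    truncation_height #|t| <= \sum_(i in t) x i].

Definition graph_associahedron_toric_variety : space R[i] :=
  toric_variety graph_associahedron.

End GraphAssociahedron.

Section Grassmannian.
Variables (R : realType) (n : nat).
Local Notation C := R[i].

Definition to_matrix (a : 'I_2 * 'I_n -> C) : 'M[C]_(2, n) :=
  \matrix_(i, j) a (i, j).

Definition stiefel : space C :=
  @subspace C (affine_space C ('I_2 * 'I_n)%type)
    [set a | \rank (to_matrix a) = 2%N].

Definition frame (a : stiefel) : 'M[C]_(2, n) := to_matrix (sval a).

Definition same_row_space (a b : stiefel) : Prop :=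
  (frame a == frame b)%MS.

(* G_{n,2}: a 2-dimensional subspace L of C^n is represented by the set of    *)
(* all 2 x n matrices with row space L.                                       *)
Definition grassmannian : space C := quotient same_row_space.

Definition row_space (a : stiefel) : grassmannian := proj same_row_space a.

Definition plucker (A : 'M[C]_(2, n)) (i j : 'I_n) : C :=
  \det (colsub (tnth [tuple i; j]) A).

(* Index sets I of Plücker coordinates are 2-element subsets of 'I_n, and a   *)
(* stratum is labelled by a set sigma of such I.                              *)
Implicit Types (I : {set 'I_n}) (sigma : {set {set 'I_n}})
  (omega : {set {set {set 'I_n}}}).

Definition stratum sigma : set grassmannian :=
  [set L | exists2 a, L = row_space a & forall i j : 'I_n, (i < j)%N ->
    plucker (frame a) i j != 0 <-> ([set i; j]%SET \in sigma)].

Definition admissible sigma : Prop :=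
  (forall I, I \in sigma -> #|I| = 2%N) /\ stratum sigma !=set0.

Definition indicator I : {ffun 'I_n -> R} := [ffun i => (i \in I)%:R].

Definition admissible_polytope sigma : set {ffun 'I_n -> R} :=
  convex_hull [set indicator I | I in [set I | I \in sigma]].

Definition hypersimplex : set {ffun 'I_n -> R} :=
  [set x | (forall i, 0 <= x i <= 1) /\ \sum_i x i = 2].

Definition chamber_set omega : set {ffun 'I_n -> R} :=
  [set x | forall sigma, sigma \in omega ->
    relative_interior (admissible_polytope sigma) x].

Definition chamber omega : Prop :=
  [/\ forall sigma, sigma \in omega -> admissible sigma,
      chamber_set omega !=set0,
      forall sigma, admissible sigma -> sigma \notin omega ->
        chamber_set omega `&` relative_interior (admissible_polytope sigma)
          = set0 &
      chamber_set omega `<=` relative_interior hypersimplex].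

Definition strata_union omega : space C :=
  subspace [set L | exists2 sigma, sigma \in omega & stratum sigma L].

Definition torus_orbit omega (L L' : strata_union omega) : Prop :=
  exists t : 'rV[C]_n, (forall i, t 0 i != 0) /\
    exists a b, [/\ sval L = row_space a, sval L' = row_space b &
      frame b = frame a *m diag_mx t].

(* F_omega, with the structure of categorical quotient by (C^* )^n. *)
Definition space_of_parameters omega : space C :=
  quotient (@torus_orbit omega).

End Grassmannian.

(* Main.v *)
Require Import Defs.
From mathcomp Require Import all_boot all_order all_algebra.
From mathcomp Require Import boolp classical_sets reals complex.
From mathcomp Require Import ring lra.
(* Imported again because mathcomp shadows [space], [morphism] and others. *)
Import Defs.

(* Omega is the chamber of a linearisation with one heavy point.  Putting it  *)
(* at infinity leaves n - 1 points of the affine line, not all equal, modulo  *)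
(* affine maps: with the first of them at 0 the others are the homogeneous    *)
(* coordinates of a point of P^{n-3}, so that F_omega = P^{n-3}.  Graph       *)
(* associahedra are truncated simplices with 3^(|t|-2) as height of the tube  *)
(* t: at a point x where the coordinate v is largest no tube containing v is  *)
(* tight, so that the tangent cone at x contains the vectors e_j - e_v.       *)
(* Hence each toric chart maps to an affine chart of P^{n-3} by               *)
(* g |-> [g(e_j - e_v)]_j; these maps glue and are bijective over the points  *)
(* having all coordinates nonzero, because the e_j - e_v generate the lattice *)
(* of integral vectors with sum 0.                                            *)

Set Implicit Arguments.
Unset Strict Implicit.
Unset Printing Implicit Defensive.
Import Order.TTheory GRing.Theory Num.Theory.
Local Open Scope classical_set_scope.
Local Open Scope ring_scope.

(** * Morphisms and quotients *)

Section Morphisms.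
Variable K : fieldType.
Implicit Types X Y Z : space K.

Lemma zopen_local X (U : set X) :
  (forall x, U x -> exists V, [/\ zopen V, V x & V `<=` U]) -> zopen U.
Proof.
move=> loc; pose S := [set V : set X | zopen V /\ V `<=` U].
suff -> : U = \bigcup_(V in S) V by apply: zopen_bigcup => V [].
apply/seteqP; split=> [x Ux|x [V [_ VU] /VU//]].
by have [V [oV Vx VU]] := loc x Ux; exists V.
Qed.

Lemma regular_subset X (U V : set X) f :
  regular U f -> zopen V -> V `<=` U -> regular V f.
Proof. by move=> rf oV VU; exact: regular_restrict rf. Qed.

Lemma regularB X (U : set X) f g :
  regular U f -> regular U g -> regular U (fun x => f x - g x).
Proof.
move=> rf rg; have rN := regular_cst (-1) (regular_open rf).
by apply: regular_ext (regularD rf (regularM rN rg)) => x _ /=; rewrite mulN1r.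
Qed.

Lemma regular_inv X (U : set X) f :
  regular U f -> (forall x, U x -> f x != 0) -> regular U (fun x => (f x)^-1).
Proof.
move=> rf fn0; apply: regular_subset (regularV rf) (regular_open rf) _.
by move=> x Ux; split=> //; exact: fn0.
Qed.

Lemma regular_div X (U : set X) f g :
  regular U f -> regular U g -> (forall x, U x -> g x != 0) ->
  regular U (fun x => f x / g x).
Proof. by move=> rf rg gn0; exact: regularM rf (regular_inv rg gn0). Qed.

Lemma regular_exprz X (U : set X) f (a : int) :
  regular U f -> (forall x, U x -> f x != 0) -> regular U (fun x => f x ^ a).
Proof.
move=> rf fn0.
have rX m : regular U (fun x => f x ^+ m).
  elim: m => [|m IHm].
    apply: regular_ext (regular_cst 1 (regular_open rf)) => x _.
    by rewrite expr0.
  by apply: regular_ext (regularM rf IHm) => x _; rewrite exprS.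
case: a => m; first exact: rX.
by apply: regular_inv (rX m.+1) _ => x Ux; rewrite expf_neq0 ?fn0.
Qed.

Lemma regular_prod X (U : set X) (I : finType) (f : I -> X -> K) :
  zopen U -> (forall i, regular U (f i)) ->
  regular U (fun x => \prod_i f i x).
Proof.
move=> oU rf.
suff h (s : seq I) : regular U (fun x => \prod_(i <- s) f i x) by exact: h.
elim: s => [|i s IHs].
  by apply: regular_ext (regular_cst 1 oU) => x _; rewrite big_nil.
by apply: regular_ext (regularM (rf i) IHs) => x _; rewrite big_cons.
Qed.

Lemma morphism_comp X Y Z (f : X -> Y) (g : Y -> Z) :
  morphism f -> morphism g -> morphism (g \o f).
Proof.
move=> [fo fr] [go gr]; split=> [U oU|U h rh]; first exact: fo (go _ oU).
exact: fr (gr _ _ rh).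
Qed.

Lemma morphism_sval X (S : set X) :
  morphism (sval : subspace S -> X).
Proof.
have fo (U : set X) : zopen U ->
    zopen ((sval : subspace S -> X) @^-1` U) by exists U.
split=> // U g rg; split; first exact: fo (regular_open rg).
by move=> x Ux; exists U, g.
Qed.

Lemma subspace_inj X (S : set X) (u v : subspace S) : sval u = sval v -> u = v.
Proof.
by case: u v => [x Sx] [y Sy] /= e; subst y; congr exist;
  exact: Prop_irrelevance.
Qed.

Lemma morphism_to_subspace X Y (S : set Y) (h : X -> subspace S) :
  morphism (fun x => sval (h x) : Y) -> morphism h.
Proof.
move=> [so sr].
have ho (U : set (subspace S)) : zopen U -> zopen (h @^-1` U).
  by move=> [V oV ->]; exact: so.
split=> // U g rg; apply: regular_glue; first exact: ho (regular_open rg).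
move=> x Ux; have [oU /(_ _ Ux)[V [k [Vx rk e]]]] := rg.
have oW := zopenI (ho _ oU) (regular_open (sr _ _ rk)).
exists (h @^-1` U `&` (fun x => sval (h x)) @^-1` V); split=> [||];
  [by []|by move=> y []|].
apply: regular_ext (regular_subset (sr _ _ rk) oW _); last by move=> y [].
by move=> y /set_mem[Uy Vy] /=; rewrite e.
Qed.

Lemma morphism_proj X (E : X -> X -> Prop) : morphism (@proj K X E : X ->
  quotient E).
Proof. by split. Qed.

Lemma proj_eq X (E : X -> X -> Prop) x y : proj E x = proj E y <-> E x = E y.
Proof.
split=> [/(congr1 sval)//|e].
by apply: eq_exist.
Qed.

Lemma morphism_of_coproduct (J : Type) (X : J -> space K) Y
    (f : coproduct X -> Y) :
  (forall j, morphism (fun x : X j => f (existT _ j x))) -> morphism f.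
Proof.
move=> fm; split=> [U oU j|U g rg j]; first exact: (fm j).1.
exact: (fm j).2.
Qed.

Lemma morphism_in_coproduct (J : Type) (X : J -> space K) (j : J) :
  morphism (existT _ j : X j -> coproduct X).
Proof. by split=> [U oU|U g rg]; [exact: oU | exact: rg]. Qed.

Lemma regular_polyfun (I : Type) (p : (I -> K) -> K) :
  polyfun p -> @regular K (affine_space K I) setT p.
Proof.
move=> pp; split; first exact: (zopenT (affine_space K I)).
move=> x _; exists p, (fun=> 1); split=> //; rewrite ?oner_neq0 //.
  exact: polyfun_cst.
by move=> y _ _; rewrite divr1.
Qed.

Lemma regular_comp_polyfun X (I : Type) (f : X -> I -> K) (p : (I -> K) -> K) :
  polyfun p -> (forall i, regular setT (fun x => f x i)) ->
  regular setT (fun x => p (f x)).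
Proof.
move=> pp rf; elim: pp => [c|i|q r _ IHq _ IHr|q r _ IHq _ IHr].
- exact: regular_cst (zopenT X).
- exact: rf.
- exact: regularD.
- exact: regularM.
Qed.

Lemma morphism_to_affine X (I : Type) (f : X -> affine_space K I) :
  (forall i, regular setT (fun x => f x i)) -> morphism f.
Proof.
move=> rf; have rp p pp := @regular_comp_polyfun X I f p pp rf.
have fo (U : set (affine_space K I)) : zopen U -> zopen (f @^-1` U).
  move=> oU; apply: zopen_local => x Ux; have [q pq [qx qU]] := oU _ Ux.
  exists (setT `&` [set y | q (f y) != 0]); split=> //.
    exact: regular_unit (rp q pq).
  by move=> y [_ /qU].
split=> // U g rg; apply: regular_glue; first exact: fo (regular_open rg).
move=> x Ux; have [oU /(_ _ Ux)[p [q [pp pq qx e]]]] := rg.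
have oW := zopenI (fo _ oU) (regular_unit (rp q pq)).
exists (f @^-1` U `&` (setT `&` [set y | q (f y) != 0])).
split=> [||]; [by []|by move=> y []|].
apply: (@regular_ext K X _ (fun y => p (f y) / q (f y))).
  by move=> y /set_mem[Uy [_ qy]] /=; rewrite e.
apply: regular_div.
- exact: regular_subset (rp p pp) oW _.
- exact: regular_subset (rp q pq) oW _.
- by move=> y [_ []].
Qed.

Definition punctured (N : nat) : set (affine_space K 'I_N) :=
  [set z | exists j, z j != 0].

Definition final X Y (f : X -> Y) : Prop :=
  [/\ forall y, exists x, f x = y,
      forall U : set Y, zopen (f @^-1` U) -> zopen U &
      forall (U : set Y) g, regular (f @^-1` U) (g \o f) -> regular U g].

Lemma final_proj X (E : X -> X -> Prop) : final (@proj K X E : X -> quotient E).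
Proof. by split=> // -[A [x Ax]]; subst A; exists x. Qed.

Lemma final_comp X Y Z (f : X -> Y) (g : Y -> Z) :
  final f -> final g -> final (g \o f).
Proof.
move=> [fs fo fr] [gs go gr]; split=> [z|U oU|U h rh].
- by have [y <-] := gs z; have [x <-] := fs y; exists x.
- exact/go/fo.
- exact/gr/fr.
Qed.

Lemma final_factor X Y Z (f : X -> Y) (g : Y -> Z) :
  morphism f -> final (g \o f) -> final g.
Proof.
move=> [fo fr] [gs go gr]; split=> [z|U oU|U h rh].
- by have [x <-] := gs z; exists (f x).
- exact: go (fo _ oU).
- exact: gr (fr _ _ rh).
Qed.

Lemma final_restrict X Y (f : X -> Y) (S : set X) (T : set Y)
    (h : subspace S -> subspace T) :
  final f -> zopen S -> S = f @^-1` T ->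
  (forall x, sval (h x) = f (sval x)) -> final h.
Proof.
move=> [fs fo fr] oS ST hf.
pose im (U : set (subspace T)) : set Y := [set y | exists2 u, U u & sval u = y].
have im_pre U V : h @^-1` U = sval @^-1` V -> f @^-1` im U = S `&` V.
  move=> UV; apply/seteqP; split=> [x [u Uu /= ux]|x [Sx Vx]].
    have Sx : S x by rewrite ST /= -ux; exact: (svalP u).
    split=> //; suff : (sval @^-1` V) (exist S x Sx) by [].
    rewrite -UV /=; suff -> : h (exist S x Sx) = u by [].
    by apply: subspace_inj; rewrite hf.
  exists (h (exist S x Sx)); last by rewrite hf.
  suff : (h @^-1` U) (exist S x Sx) by [].
  by rewrite UV.
have im_open U : zopen (h @^-1` U) -> zopen (f @^-1` im U).
  by move=> [V oV /im_pre ->]; exact: zopenI.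
have imK U : U = sval @^-1` im U.
  apply/seteqP; split=> [u Uu|u [u' Uu' e]]; first by exists u.
  by have <- : u' = u by apply: subspace_inj.
split=> [[y Ty]|U oU|U g rg].
- have [x fx] := fs y; have Sx : S x by rewrite ST /= fx.
  by exists (exist S x Sx); apply: subspace_inj; rewrite hf.
- by rewrite [U]imK; exists (im U) => //; exact/fo/im_open.
pose g' y := if pselect (T y) is left Ty then g (exist T y Ty) else 0.
have g'E (u : subspace T) : g' (sval u) = g u.
  rewrite /g'; case: pselect => [Tu|]; last by case; exact: (svalP u).
  by congr g; apply: subspace_inj.
have rg' : regular (im U) g'.
  apply/fr/regular_glue; first exact/im_open/(regular_open rg).
  move=> x [u Uu ux]; have Sx : S x by rewrite ST /= -ux; exact: (svalP u).
  have hx : h (exist S x Sx) = u by apply: subspace_inj; rewrite hf.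
  have [[V oV UV] /(_ (exist S x Sx))[|W [k [Wx rk e]]]] := rg.
    by rewrite /= hx.
  have WSV : zopen (W `&` (S `&` V)).
    by apply: zopenI; [exact: regular_open rk | exact: zopenI].
  have USV (y : X) (Sy : S y) (Vy : V y) : U (h (exist S y Sy)).
    suff : (h @^-1` U) (exist S y Sy) by [].
    by rewrite UV.
  have Vx : V x.
    suff : (sval @^-1` V) (exist S x Sx) by [].
    by rewrite -UV /= hx.
  exists (W `&` (S `&` V)); split=> //.
    by rewrite -(im_pre _ _ UV) => y [].
  apply: regular_ext (regular_subset rk WSV _); last by move=> y [].
  move=> y /set_mem[Wy [Sy Vy]] /=.
  rewrite -(e (exist S y Sy)) //=; last exact: USV.
  by rewrite -g'E hf.
split; first by rewrite [U]imK; exists (im U) => //; exact: regular_open rg'.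
by move=> u Uu; exists (im U), g'; split=> //; first by exists u.
Qed.

Lemma affine_open_poly (I : Type) (U : set (affine_space K I)) x :
  zopen U -> U x -> exists2 q, polyfun q & q x != 0 /\ forall y, q y != 0 ->
    U y.
Proof. by move=> oU; exact: oU. Qed.

End Morphisms.

Arguments punctured : clear implicits.

(** * Projective space *)

Section Nonvanishing.
Variable K : numFieldType.

Lemma poly_nonroot (P : {poly K}) : P != 0 -> exists s, P.[s] != 0.
Proof.
move=> P0; apply: contrapT => h.
pose rs : seq K := [seq i%:R | i <- iota 0 (size P)].
have := @max_poly_roots _ P rs P0; rewrite size_map size_iota ltnn.
suff [-> ->] : all (root P) rs /\ uniq rs by move/(_ isT isT).
split; last first.
  rewrite map_inj_uniq ?iota_uniq // => i j /eqP; rewrite eqr_nat => /eqP//.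
apply/allP => s _; apply/eqP; apply: contrapT => /eqP Ps.
by apply: h; exists s.
Qed.

Lemma polyfun_line (I : Type) (p : (I -> K) -> K) (x y : I -> K) :
  polyfun p -> exists P : {poly K},
    forall s, P.[s] = p (fun i => x i + s * (y i - x i)).
Proof.
elim=> [c|i|q r _ [Q Qe] _ [Q' Qe']|q r _ [Q Qe] _ [Q' Qe']].
- by exists c%:P => s; rewrite hornerC.
- by exists ((x i)%:P + 'X * (y i - x i)%:P) => s; rewrite !hornerE.
- by exists (Q + Q') => s; rewrite hornerD Qe Qe'.
- by exists (Q * Q') => s; rewrite hornerM Qe Qe'.
Qed.

Lemma polyfun_common_nonzero (I : Type) (p q : (I -> K) -> K) x y :
  polyfun p -> polyfun q -> p x != 0 -> q y != 0 ->
  exists z, p z != 0 /\ q z != 0.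
Proof.
move=> pp pq px qy.
have [P Pe] := polyfun_line x y pp; have [Q Qe] := polyfun_line x y pq.
have P0 : P.[0] = p x.
  by rewrite Pe; congr p; apply/funext => i; rewrite mul0r addr0.
have Q1 : Q.[1] = q y.
  by rewrite Qe; congr q; apply/funext => i; rewrite mul1r addrC subrK.
have [|s] := @poly_nonroot (P * Q).
  rewrite mulf_neq0 //; first by apply: contraNneq px => P00;
    rewrite -P0 P00 horner0.
  by apply: contraNneq qy => Q00; rewrite -Q1 Q00 horner0.
rewrite hornerM mulf_eq0 negb_or Pe Qe => /andP[? ?].
by exists (fun i => x i + s * (y i - x i)).
Qed.

End Nonvanishing.

Section ProjectiveSpace.
Variables (K : numFieldType) (N : nat) (Y : space K).
Variable (h : subspace (punctured K N) -> Y).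
Hypothesis mh : morphism h.
Hypothesis fh : final h.
Hypothesis h_eq : forall z w, h z = h w <->
  exists2 c, c != 0 & sval w = fun j => c * sval z j.

Lemma h_surj y : exists z, h z = y.
Proof. by case: fh => s _ _; exact: s. Qed.

Definition homog_repr y := projT1 (cid (h_surj y)).

Lemma homog_reprK y : h (homog_repr y) = y.
Proof. exact: (projT2 (cid (h_surj y))). Qed.

Definition ratio (j i : 'I_N) (y : Y) : K :=
  sval (homog_repr y) j / sval (homog_repr y) i.

Lemma ratioE j i z : ratio j i (h z) = sval z j / sval z i.
Proof.
have /esym/h_eq[c c0 e] := homog_reprK (h z).
by rewrite /ratio e -mulf_div divff // mul1r.
Qed.

Definition std_chart (i : 'I_N) : set Y := [set y | sval (homog_repr y) i != 0].

Lemma std_chartE i z : std_chart i (h z) <-> sval z i != 0.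
Proof.
have /esym/h_eq[c c0 e] := homog_reprK (h z).
by rewrite /std_chart /= e mulf_eq0 (negPf c0).
Qed.

Lemma std_chart_cover y : exists i, std_chart i y.
Proof. exact: (svalP (homog_repr y)). Qed.

Lemma regular_homog_coord j :
  @regular _ (subspace (punctured K N)) setT (fun z => sval z j).
Proof.
have [_ ms] := @morphism_sval _ _ (punctured K N).
have := ms _ _ (regular_polyfun (@polyfun_coord K 'I_N j)); exact.
Qed.

Lemma preimage_std_chart i :
  h @^-1` std_chart i = setT `&` [set z | sval z i != 0].
Proof. by apply/seteqP; split=> [z /std_chartE|z [_ /std_chartE]]. Qed.

Lemma zopen_std_chart i : zopen (std_chart i).
Proof.
have [_ go _] := fh; apply: go; rewrite preimage_std_chart.
exact: regular_unit (regular_homog_coord i).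
Qed.

Lemma regular_ratio j i : regular (std_chart i) (ratio j i).
Proof.
have [_ _ gr] := fh; apply: gr; rewrite preimage_std_chart.
have rj k := regular_subset (regular_homog_coord k)
  (regular_unit (regular_homog_coord i)) (fun _ _ => I).
apply: regular_ext (regular_div (rj j) (rj i) _) => [z _|z []//] /=.
by rewrite ratioE.
Qed.

Lemma projective_irreducible : (0 < N)%N -> irreducible Y.
Proof.
move=> N0; split.
  have z1 : punctured K N (fun=> 1) by exists (Ordinal N0); rewrite oner_neq0.
  by exists (h (exist _ _ z1)).
move=> U V oU oV [u Uu] [v Vv]; have [ho _] := mh.
move: Uu Vv; rewrite -(homog_reprK u) -(homog_reprK v).
move: (homog_repr u) (homog_repr v) => x y Ux Vy.
have [U' oU' eU] := ho _ oU; have [V' oV' eV] := ho _ oV.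
have U'x : U' (sval x) by have : (h @^-1` U) x by []; rewrite eU.
have V'y : V' (sval y) by have : (h @^-1` V) y by []; rewrite eV.
have [p pp [px pU]] := affine_open_poly oU' U'x.
have [q pq [qy qV]] := affine_open_poly oV' V'y.
have [j xj] := svalP x.
have pxj : p (sval x) * sval x j != 0 by exact: mulf_neq0.
have [z [pz qz]] :=
  polyfun_common_nonzero (polyfunM pp (polyfun_coord K j)) pq pxj qy.
move: pz; rewrite mulf_eq0 negb_or => /andP[pz zj].
have wz : punctured K N z by exists j.
exists (h (exist _ z wz)); split.
  suff : (h @^-1` U) (exist _ z wz) by [].
  by rewrite eU; exact: pU.
suff : (h @^-1` V) (exist _ z wz) by [].
by rewrite eV; exact: qV.
Qed.

Lemma proportional (z w : subspace (punctured K N)) a b :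
  sval z a != 0 -> sval w b != 0 ->
  (forall i j, sval z i * sval w j = sval z j * sval w i) -> h z = h w.
Proof.
move=> za wb e; apply/h_eq.
have wa : sval w a != 0.
  apply/eqP => wa; have := e a b; rewrite wa mulr0 => /eqP.
  by rewrite mulf_eq0 (negPf za) (negPf wb).
exists (sval w a / sval z a); first by rewrite mulf_neq0 ?invr_eq0.
by apply/funext => j; rewrite mulrAC [sval w a * _]mulrC -e mulrAC divff ?mul1r.
Qed.

Lemma projective_separated : separated Y.
Proof.
move=> Z f g [fo fr] [go gr]; apply: zopen_local => z0 /= fg.
have [a fa] := std_chart_cover (f z0); have [b gb] := std_chart_cover (g z0).
have oW : zopen (f @^-1` std_chart a `&` g @^-1` std_chart b).
  by apply: zopenI; [apply: fo | apply: go]; exact: zopen_std_chart.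
pose F i j z := ratio i a (f z) * ratio j b (g z)
  - ratio j a (f z) * ratio i b (g z).
have rF i j : regular (f @^-1` std_chart a `&` g @^-1` std_chart b) (F i j).
  have rf k := regular_subset (fr _ _ (regular_ratio k a)) oW (@subIsetl _ _ _).
  have rg k := regular_subset (gr _ _ (regular_ratio k b)) oW (@subIsetr _ _ _).
  by apply: regularB; apply: regularM;
    [exact: rf|exact: rg|exact: rf|exact: rg].
have [i [j Fij]] : exists i j, F i j z0 != 0.
  apply: contrapT => nF; apply: fg.
  move: fa gb nF; rewrite /F -[f z0]homog_reprK -[g z0]homog_reprK.
  move: (homog_repr _) (homog_repr _) => z w /std_chartE za /std_chartE wb nF.
  apply: (proportional za wb) => i j; apply: contrapT => ne.
  apply: nF; exists i, j; rewrite !ratioE !mulf_div -mulrBl mulf_neq0 //.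
    by rewrite subr_eq0; apply/eqP.
  by rewrite invr_eq0 mulf_neq0.
exists (f @^-1` std_chart a `&` g @^-1` std_chart b `&` [set z | F i j z != 0]).
split; [exact: regular_unit (rF i j)|by []|move=> z [_ /= Fz] fgz].
move: Fz; rewrite /F fgz /ratio !mulf_div.
by rewrite -mulrBl [X in _ - X]mulrC subrr mul0r eqxx.
Qed.

Lemma affine_std_chart i : affine (subspace (std_chart i)).
Proof.
pose p (z : 'I_N -> K) := z i + -1.
exists N, [set p]; split.
  by move=> _ ->; apply: polyfunD; [exact: polyfun_coord|exact: polyfun_cst].
pose Z : set (affine_space K 'I_N) := [set z | forall q, [set p] q -> q z = 0].
have ZP z : Z z <-> z i = 1.
  split=> [/(_ p erefl)/eqP|zi _ ->]; first by rewrite subr_eq0 => /eqP.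
  by rewrite /p zi subrr.
have toZ (y : subspace (std_chart i)) : Z (fun j => ratio j i (sval y)).
  by apply/ZP; rewrite /ratio divff //; exact: (svalP y).
pose phi (y : subspace (std_chart i)) : subspace Z := exist _ _ (toZ y).
have Zpunct (z : subspace Z) : punctured K N (sval z).
  by exists i; have /ZP -> := svalP z; rewrite oner_neq0.
pose w (z : subspace Z) : subspace (punctured K N) := exist _ _ (Zpunct z).
have toC (z : subspace Z) : std_chart i (h (w z)).
  by apply/std_chartE => /=; have /ZP -> := svalP z; rewrite oner_neq0.
pose psi (z : subspace Z) : subspace (std_chart i) := exist _ _ (toC z).
exists phi; split; last (exists psi; split).
- apply: morphism_to_subspace; apply: morphism_to_affine => j /=.
  have [_ ms] := @morphism_sval _ _ (std_chart i).
  apply: regular_subset (ms _ _ (regular_ratio j i)) (zopenT _) _ => y _.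
  exact: (svalP y).
- apply: morphism_to_subspace; apply: morphism_comp mh.
  by apply: morphism_to_subspace; exact: morphism_sval.
- move=> y; apply: subspace_inj => /=; rewrite -[RHS]homog_reprK; apply/h_eq.
  exists (sval (homog_repr (sval y)) i); first exact: (svalP y).
  apply/funext => j /=; rewrite /ratio mulrC divfK //; exact: (svalP y).
- move=> z; apply: subspace_inj; apply/funext => j /=.
  by rewrite ratioE /=; have /ZP -> := svalP z; rewrite divr1.
Qed.

Lemma projective_variety : (0 < N)%N -> variety Y.
Proof.
move=> N0; split; [exact: projective_irreducible|exact: projective_separated|].
exists N, std_chart; split; first exact: std_chart_cover.
by move=> i; split; [exact: zopen_std_chart|exact: affine_std_chart].
Qed.

End ProjectiveSpace.

(** * Toric varieties mapping to projective space *)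

Section Monomials.
Variables (K : numFieldType) (V : finType).
Implicit Types (a b : {ffun V -> int}) (t u w : V -> K).

Definition monomial w a : K := \prod_i w i ^ a i.

Lemma monomial0 w : monomial w 0 = 1.
Proof. by apply: big1 => i _; rewrite ffunE expr0z. Qed.

Lemma monomialD w a b : (forall i, w i != 0) ->
  monomial w (a + b) = monomial w a * monomial w b.
Proof.
move=> w0; rewrite /monomial -big_split; apply: eq_bigr => i _ /=.
by rewrite ffunE expfzDr.
Qed.

Lemma monomial_neq0 w a : (forall i, w i != 0) -> monomial w a != 0.
Proof. by move=> w0; apply/prodf_neq0 => i _; rewrite expfz_neq0. Qed.

Lemma monomialMl u w a :
  monomial (fun i => u i * w i) a = monomial u a * monomial w a.
Proof.
rewrite /monomial -big_split; apply: eq_bigr => i _ /=.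
by rewrite expfzMl.
Qed.

Lemma monomial_separates a b : a != b ->
  exists2 u, forall i, u i != 0 & monomial u a != monomial u b.
Proof.
move=> ab; have [i abi] : exists i, a i != b i.
  apply: contrapT => h; case/eqP: ab; apply/ffunP => i; apply: contrapT => abi.
  by apply: h; exists i; apply/eqP.
have two0 : 2%:R != 0 :> K by rewrite pnatr_eq0.
have e c : monomial (fun j => if j == i then 2%:R else 1) c = 2%:R ^ c i.
  rewrite /monomial (bigD1 i) //= eqxx big1 ?mulr1 // => j /negPf ->.
  exact: exp1rz.
exists (fun j => if j == i then 2%:R else 1) => [j|].
  by case: ifP; rewrite ?oner_neq0.
have ratE (z : int) : (2%:R : K) ^ z = ratr ((2%:R : rat) ^ z).
  by rewrite fmorphXz rmorph_nat.
rewrite !e !ratE; apply: contraNneq abi => /fmorph_inj ab2; apply/eqP.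
by apply: ieexprIz ab2.
Qed.

Lemma monomial_independent_uniq (A : seq {ffun V -> int})
    (c : {ffun V -> int} -> K) : uniq A ->
  (forall w, (forall i, w i != 0) -> \sum_(a <- A) c a * monomial w a = 0) ->
  forall a, a \in A -> c a = 0.
Proof.
elim: A c => [//|a0 A IHA] c /andP[a0A uA] h.
have cA a : a \in A -> c a = 0.
  move=> aA; have aa0 : a != a0 by apply: contraNneq a0A => <-.
  have [u u0 ne] := monomial_separates aa0.
  suff /eqP : c a * (monomial u a - monomial u a0) = 0.
    by rewrite mulf_eq0 subr_eq0 (negPf ne) orbF => /eqP.
  apply: (IHA (fun a => c a * (monomial u a - monomial u a0))) => // w w0.
  have uw0 i : u i * w i != 0 by rewrite mulf_neq0.
  have := h _ uw0; have := h _ w0; rewrite !big_cons.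
  move=> /eqP; rewrite addr_eq0 => /eqP e1 /eqP; rewrite addr_eq0 => /eqP.
  rewrite monomialMl mulrCA e1 mulrN => /oppr_inj e2.
  apply/eqP; under eq_bigr do rewrite mulrBr mulrBl; rewrite sumrB subr_eq0.
  rewrite eq_sym; apply/eqP.
  transitivity (monomial u a0 * \sum_(j <- A) c j * monomial w j).
    by rewrite big_distrr /=; apply: eq_bigr => j _;
      rewrite mulrA [_ * c j]mulrC.
  rewrite e2; apply: eq_bigr => j _.
  by rewrite monomialMl mulrA.
move=> a; rewrite inE => /orP[/eqP ->|]; last exact: cA.
have := h (fun=> 1) (fun=> oner_neq0 _); rewrite big_cons big_seq big1 ?addr0.
  by move/eqP; rewrite mulf_eq0 (negPf (monomial_neq0 _ _)) ?orbF => [/eqP|] // i; rewrite oner_neq0.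
by move=> j jA; rewrite cA ?mul0r.
Qed.

Lemma monomial_independent (s : seq (K * {ffun V -> int}))
    (G : {ffun V -> int} -> K) :
  \sum_(p <- s) p.1 * G p.2 != 0 ->
  exists2 w, forall i, w i != 0 & \sum_(p <- s) p.1 * monomial w p.2 != 0.
Proof.
pose A := undup [seq p.2 | p <- s].
pose c a := \sum_(p <- s | p.2 == a) p.1.
have e H : \sum_(p <- s) p.1 * H p.2 = \sum_(a <- A) c a * H a.
  under [RHS]eq_bigr do rewrite big_distrl /= big_mkcond /=.
  rewrite exchange_big /=; apply: eq_big_seq => p ps.
  have pA : p.2 \in A by rewrite mem_undup; apply: map_f.
  rewrite (bigD1_seq p.2) ?undup_uniq //= eqxx big1 ?addr0 // => a.
  by rewrite eq_sym => /negPf ->.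
rewrite e => G0; apply: contrapT => h; case/eqP: G0.
rewrite big_seq big1 // => a aA;
  rewrite (monomial_independent_uniq _ _ aA) ?mul0r //.
  exact: undup_uniq.
move=> w w0; apply: contrapT => /eqP ne; apply: h; exists w => //.
by rewrite e.
Qed.

End Monomials.

Section ToricMorphism.
Variables (R : realType) (V : finType) (P : set {ffun V -> R}).
Local Notation C := R[i].
Implicit Types (x y : {ffun V -> R}) (a b : {ffun V -> int}) (w : V -> C).

Definition edge_vector (v j : V) : {ffun V -> int} :=
  [ffun i => (i == j)%:R - (i == v)%:R].

Definition convex (S : set {ffun V -> R}) : Prop :=
  forall x y (c d : R), S x -> S y -> 0 <= c -> 0 <= d -> c + d = 1 ->
    S [ffun i => c * x i + d * y i].

(* A vertex v of the standard simplex whose tangent cone is contained in the  *)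
(* tangent cone of P at x: the chart at x maps to the affine chart z_v <> 0.  *)
Definition dominates x (v : V) : Prop :=
  forall j, tangent_semigroup P x (edge_vector v j).

Hypothesis convP : convex P.
Hypothesis sumP : exists c, forall x, P x -> \sum_i x i = c.
Hypothesis domP : forall x, P x -> exists v, dominates x v.

Definition midpoint x y : {ffun V -> R} := [ffun i => (x i + y i) / 2].

Lemma midpoint_in x y : P x -> P y -> P (midpoint x y).
Proof.
move=> Px Py; have -> : midpoint x y = [ffun i => 2^-1 * x i + 2^-1 * y i].
  by apply/ffunP => i; rewrite !ffunE mulrDl ![_ / 2]mulrC.
by apply: convP => //; lra.
Qed.

Lemma midpointC x y : midpoint x y = midpoint y x.
Proof. by apply/ffunP => i; rewrite !ffunE addrC. Qed.

Lemma midpointxx x : midpoint x x = x.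
Proof. by apply/ffunP => i; rewrite ffunE; lra. Qed.

Lemma tangent0 x : P x -> tangent_semigroup P x 0.
Proof.
move=> Px; exists 1; rewrite ?ltr01 //.
suff -> : [ffun i => x i + 1 * ((0 : {ffun V -> int}) i)%:~R] = x by [].
by apply/ffunP => i; rewrite !ffunE mulr0z mulr0 addr0.
Qed.

Lemma tangentD x a b : tangent_semigroup P x a -> tangent_semigroup P x b ->
  tangent_semigroup P x (a + b).
Proof.
move=> [e e0 ea] [d d0 db]; have ed0 : 0 < e + d by rewrite addr_gt0.
exists (e * d / (e + d)); first by rewrite divr_gt0 // mulr_gt0.
have := convP ea db (_ : 0 <= d / (e + d)) (_ : 0 <= e / (e + d)).
move=> /(_ (ltW (divr_gt0 d0 ed0)) (ltW (divr_gt0 e0 ed0))) h.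
have {h} := h _; rewrite -mulrDl addrC divff ?gt_eqF // => /(_ erefl).
congr P; apply/ffunP => i; rewrite !ffunE intrD.
set u := (a i)%:~R; set v := (b i)%:~R.
by field; rewrite gt_eqF.
Qed.

Lemma tangent_midpoint x y a : P y ->
  tangent_semigroup P x a -> tangent_semigroup P (midpoint x y) a.
Proof.
move=> Py [e e0 ea]; exists (e / 2); first by rewrite divr_gt0.
suff -> : [ffun i => midpoint x y i + e / 2 * (a i)%:~R] =
  midpoint [ffun i => x i + e * (a i)%:~R] y by exact: midpoint_in.
apply/ffunP => i; rewrite !ffunE; set u := (a i)%:~R.
by rewrite -mulrA [_^-1 * u]mulrC mulrA -mulrDl addrAC.
Qed.

Lemma tangent_sum0 x a : P x -> tangent_semigroup P x a -> \sum_i a i = 0.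
Proof.
move=> Px [e e0 ea]; have [c cP] := sumP.
have := cP _ ea; under eq_bigr do rewrite ffunE.
rewrite big_split /= cP // -[RHS]addr0 => /addrI /eqP.
rewrite -mulr_sumr mulf_eq0 gt_eqF //= => /eqP h.
by apply/eqP; rewrite -(intr_eq0 R) rmorph_sum /= h.
Qed.

Definition character x (g : toric_chart P x) a : C :=
  if pselect (tangent_semigroup P x a) is left s then sval g (exist _ a s)
  else 0.

Lemma characterE x (g : toric_chart P x) (s : semigroup_index P x) :
  sval g s = character g (sval s).
Proof.
case: s => a s; rewrite /character; case: pselect => //= s'.
by congr (sval g (exist _ a _)); exact: Prop_irrelevance.
Qed.

Lemma character0 x (g : toric_chart P x) : P x -> character g 0 = 1.
Proof.
move=> Px; rewrite -(characterE g (exist _ 0 (tangent0 Px))).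
exact: (svalP g).1.
Qed.

Lemma characterD x (g : toric_chart P x) a b :
  tangent_semigroup P x a -> tangent_semigroup P x b ->
  character g (a + b) = character g a * character g b.
Proof.
move=> sa sb; rewrite -(characterE g (exist _ a sa)) -(characterE g (exist _ b sb)).
rewrite -(characterE g (exist _ (a + b) (tangentD sa sb))).
exact: (svalP g).2.
Qed.

Lemma torus_hom x (w : V -> C) : (forall i, w i != 0) ->
  @monoid_hom R V P x (fun s => monomial w (sval s)).
Proof.
move=> w0; split=> [s ->|s t r ->]; first exact: monomial0.
exact: monomialD.
Qed.

Definition torus_chart x w (w0 : forall i, w i != 0) : toric_chart P x :=
  exist _ _ (torus_hom x w0).

Lemma character_torus x w (w0 : forall i, w i != 0) a :
  tangent_semigroup P x a -> character (torus_chart x w0) a = monomial w a.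
Proof. by move=> sa; rewrite -(characterE _ (exist _ a sa)). Qed.

Lemma toric_glueP (p q : toric_charts P) :
  toric_glue p q <->
  exists k : toric_chart P (midpoint (sval (projT1 p)) (sval (projT1 q))),
    (forall a, tangent_semigroup P (sval (projT1 p)) a ->
      character (projT2 p) a = character k a) /\
    (forall a, tangent_semigroup P (sval (projT1 q)) a ->
      character (projT2 q) a = character k a).
Proof.
case: p q => [[x Px] g] [[y Py] h] /=.
split=> -[k [kg kh]]; exists k.
  split=> a sa.
    have sa' := tangent_midpoint Py sa.
    rewrite -(characterE g (exist _ a sa)) -(characterE k (exist _ a sa')).
    exact: kg.
  have sa' : tangent_semigroup P (midpoint x y) a.
    by rewrite midpointC; exact: tangent_midpoint.
  rewrite -(characterE h (exist _ a sa)) -(characterE k (exist _ a sa')).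
  exact: kh.
split=> a b ab.
  by rewrite (characterE g) (characterE k) -ab; apply: kg; exact: (svalP a).
by rewrite (characterE h) (characterE k) -ab; apply: kh; exact: (svalP a).
Qed.

Lemma toric_glue_refl (p : toric_charts P) : toric_glue p p.
Proof.
apply/toric_glueP; case: p => [[x Px] g] /=; rewrite midpointxx.
by exists g.
Qed.

Lemma edge_vectorxx v : edge_vector v v = 0.
Proof. by apply/ffunP => i; rewrite !ffunE subrr. Qed.

Lemma edge_vectorD u v j : edge_vector u v + edge_vector v j = edge_vector u j.
Proof. by apply/ffunP => i; rewrite !ffunE addrC addrA subrK. Qed.

Lemma character_edge_neq0 x (g : toric_chart P x) u v : P x ->
  dominates x u -> dominates x v -> character g (edge_vector u v) != 0.
Proof.
move=> Px du dv; apply/eqP => g0; have := characterD g (du v) (dv u).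
rewrite g0 mul0r edge_vectorD edge_vectorxx character0 // => /eqP.
by rewrite oner_eq0.
Qed.

Lemma sum_edge_vector v (n : V -> nat) i :
  (\sum_j edge_vector v j *+ n j) i
  = (n i)%:Z - (i == v)%:R * \sum_j (n j)%:Z.
Proof.
have mulnE (c : int) m : c *+ m = c * m%:Z by rewrite -mulr_natr natz.
rewrite sum_ffunE.
under eq_bigr do rewrite ffunMnE ffunE mulrnBl.
rewrite sumrB; congr (_ - _); last first.
  rewrite mulr_sumr; apply: eq_bigr => j _.
  by rewrite mulnE.
rewrite (bigD1 i) //= eqxx big1 ?addr0; first by rewrite mulnE mul1r.
move=> j.
by rewrite eq_sym => /negPf ->; rewrite mul0rn.
Qed.

Lemma edge_vectors_generate v a : \sum_i a i = 0 ->
  exists m n : V -> nat, a + \sum_j edge_vector v j *+ m j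
    = \sum_j edge_vector v j *+ n j.
Proof.
move=> a0; exists (fun j => absz (a j)), (fun j => absz (a j + `|a j|)).
have e j : (absz (a j + `|a j|))%:Z = a j + (absz (a j))%:Z.
  by rewrite gez0_abs ?abszE // -lerBlDl sub0r -normrN ler_norm.
apply/ffunP => i; rewrite ffunE !sum_edge_vector e.
under [X in _ = _ - _ * X]eq_bigr do rewrite e.
by rewrite big_split /= a0 add0r addrA.
Qed.

Lemma character_edges x (g : toric_chart P x) v w :
  P x -> dominates x v -> (forall i, w i != 0) ->
  (forall j, character g (edge_vector v j) = monomial w (edge_vector v j)) ->
  forall a, tangent_semigroup P x a -> character g a = monomial w a.
Proof.
move=> Px dv w0 gw a sa.
have [m [n e]] := edge_vectors_generate v (tangent_sum0 Px sa).
pose Q b := tangent_semigroup P x b /\ character g b = monomial w b.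
have Q0 : Q 0 by split; [exact: tangent0 | rewrite character0 // monomial0].
have QD b c : Q b -> Q c -> Q (b + c).
  move=> [sb gb] [sc gc]; split; first exact: tangentD.
  by rewrite characterD // gb gc monomialD.
have Qs (k : V -> nat) : Q (\sum_j edge_vector v j *+ k j).
  apply: big_ind => // j _; elim: (k j) => [|l IHl]; first by rewrite mulr0n.
  by rewrite mulrS; apply: QD => //.
have [sm gm] := Qs m; have [sn gn] := Qs n.
apply: (mulIf (monomial_neq0 (\sum_j edge_vector v j *+ m j) w0)).
by rewrite -{1}gm -characterD // e gn -e monomialD.
Qed.

Lemma polyfun_characters x (q : (semigroup_index P x -> C) -> C) : P x ->
  polyfun q -> exists2 s : seq (C * {ffun V -> int}),
    forall p, p \in s -> tangent_semigroup P x p.2 &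
    forall g : toric_chart P x,
      q (sval g) = \sum_(p <- s) p.1 * character g p.2.
Proof.
move=> Px; elim=> [c|u|q1 q2 _ [s1 h1 e1] _ [s2 h2 e2]|q1 q2 _ [s1 h1 e1] _ [s2 h2 e2]].
- exists [:: (c, 0)] => [p|g]; first by rewrite inE => /eqP ->; exact: tangent0.
  by rewrite big_seq1 character0 // mulr1.
- exists [:: (1, sval u)] => [p|g]; first by rewrite inE => /eqP ->;
  exact: (svalP u).
  by rewrite big_seq1 mul1r characterE.
- exists (s1 ++ s2) => [p|g]; first by rewrite mem_cat => /orP[/h1|/h2].
  by rewrite e1 e2 big_cat.
exists [seq (p.1 * r.1, p.2 + r.2) | p <- s1, r <- s2] => [p|g].
  by move=> /allpairsP[[p1 p2] [/= /h1 ? /h2 ? ->]]; exact: tangentD.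
rewrite e1 e2 big_allpairs_dep mulr_suml; apply: eq_big_seq => p ps /=.
rewrite mulr_sumr; apply: eq_big_seq => r rs /=.
by rewrite characterD; [exact: mulrACA|exact: h1|exact: h2].
Qed.

Lemma torus_dense x (U : set (toric_chart P x)) : P x -> zopen U ->
  U !=set0 -> exists w (w0 : forall i, w i != 0), U (torus_chart x w0).
Proof.
move=> Px [U' oU' ->] [g U'g].
have [q pq [qg qU]] := affine_open_poly oU' U'g.
have [s sS e] := polyfun_characters Px pq.
move: qg; rewrite e => /monomial_independent[w w0 sw].
exists w, w0; apply: qU; rewrite (e (torus_chart x w0)).
rewrite (eq_big_seq (fun p => p.1 * monomial w p.2)) // => p ps.
by rewrite character_torus //; exact: sS.
Qed.

Variables (N : nat) (e : 'I_N -> V) (e' : V -> 'I_N).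
Hypotheses (eK : cancel e e') (e'K : cancel e' e).
Variables (Y : space C) (h : subspace (punctured C N) -> Y).
Hypothesis mh : morphism h.
Hypothesis fh : final h.
Hypothesis h_eq : forall z z', h z = h z' <->
  exists2 c, c != 0 & sval z' = fun j => c * sval z j.
Hypothesis P0 : P !=set0.

Definition simplex_coord x (g : toric_chart P x) v : affine_space C 'I_N :=
  fun j => character g (edge_vector v (e j)).

Lemma simplex_coord_punctured x (g : toric_chart P x) v : P x ->
  punctured C N (simplex_coord g v).
Proof.
move=> Px; exists (e' v); rewrite /simplex_coord e'K edge_vectorxx.
by rewrite character0 // oner_neq0.
Qed.

Definition simplex_point x (Px : P x) (g : toric_chart P x) v :
    subspace (punctured C N) :=
  exist _ _ (simplex_coord_punctured g v Px).

Lemma simplex_point_indep x (Px : P x) (g : toric_chart P x) u v :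
  dominates x u -> dominates x v ->
  h (simplex_point Px g u) = h (simplex_point Px g v).
Proof.
move=> du dv; apply/h_eq; exists (character g (edge_vector v u)).
  exact: character_edge_neq0.
apply/funext => j /=; rewrite /simplex_coord -(edge_vectorD v u).
exact: characterD (dv u) (du (e j)).
Qed.

Definition dominating (x : {x | P x}) : V := projT1 (cid (domP (svalP x))).

Lemma dominatingP (x : {x | P x}) : dominates (sval x) (dominating x).
Proof. exact: (projT2 (cid (domP (svalP x)))). Qed.

Definition chart_map (p : toric_charts P) : Y :=
  let: existT x g := p in h (simplex_point (svalP x) g (dominating x)).

Lemma chart_map_glue p q : toric_glue p q -> chart_map p = chart_map q.
Proof.
move=> /toric_glueP; case: p q => [x g] [y g'] /= [k [kg kg']].
have Pm := midpoint_in (svalP x) (svalP y).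
have dx : dominates (midpoint (sval x) (sval y)) (dominating x).
  by move=> j; apply: tangent_midpoint (svalP y) (dominatingP _ _).
have dy : dominates (midpoint (sval x) (sval y)) (dominating y).
  move=> j; rewrite midpointC.
  exact: tangent_midpoint (svalP x) (dominatingP _ _).
transitivity (h (simplex_point Pm k (dominating x))).
  congr h; apply: subspace_inj; apply/funext => j /=.
  by rewrite /simplex_coord kg //; exact: dominatingP.
rewrite (simplex_point_indep _ _ dx dy).
congr h; apply: subspace_inj; apply/funext => j /=.
by rewrite /simplex_coord kg' //; exact: dominatingP.
Qed.

Lemma morphism_chart_map : morphism chart_map.
Proof.
apply: morphism_of_coproduct => x /=; apply: morphism_comp mh.
apply: morphism_to_subspace; apply: morphism_to_affine => j.
have dj : tangent_semigroup P (sval x) (edge_vector (dominating x) (e j)).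
  exact: dominatingP.
have [_ ms] := @morphism_sval _ _ (@monoid_hom R V P (sval x)).
have := ms _ _ (regular_polyfun (polyfun_coord C (exist _ _ dj))).
apply: regular_ext => g _ /=.
by rewrite /simplex_coord -(characterE g (exist _ _ dj)).
Qed.

Lemma torus_chart_map (x : {x | P x}) w (w0 : forall i, w i != 0)
    (g : toric_chart P (sval x)) (z : subspace (punctured C N)) :
  sval z = w \o e ->
  chart_map (existT _ x g) = h z <->
  forall a, tangent_semigroup P (sval x) a -> character g a = monomial w a.
Proof.
move=> zw; rewrite /=.
have we (u v : V) : monomial w (edge_vector u v) = w v / w u.
  have [->|uv] := eqVneq u v.
    by rewrite edge_vectorxx monomial0 divff.
  rewrite /monomial (bigD1 v) //= (bigD1 u) //= !ffunE !eqxx.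
  rewrite (negPf uv) eq_sym (negPf uv) subr0 sub0r big1 ?mulr1 // => i.
  by move=> /andP[/negPf iv /negPf iu]; rewrite ffunE iv iu subr0.
split=> [/esym/h_eq[c c0 /= gz]|gw].
  apply: (character_edges (svalP x) (dominatingP x) w0) => j.
  have ge v : character g (edge_vector (dominating x) v) = c * w v.
    have /(congr1 (fun F => F (e' v))) := gz.
    by rewrite /simplex_coord zw /= !e'K.
  have := ge (dominating x); rewrite edge_vectorxx character0;
    last exact: (svalP x).
  move=> c1.
  rewrite ge we mulrC; congr (_ * _); apply: (mulIf (w0 (dominating x))).
  by rewrite -c1 mulVf.
apply/esym/h_eq; exists (w (dominating x))^-1; first by rewrite invr_eq0.
apply/funext => j /=; rewrite /simplex_coord gw; last exact: dominatingP.
by rewrite we zw mulrC.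
Qed.

Lemma torus_class (p q : toric_charts P) w (z : subspace (punctured C N)) :
  (forall i, w i != 0) -> sval z = w \o e -> chart_map p = h z ->
  toric_glue p q <-> chart_map q = h z.
Proof.
move=> w0 zw pz; split=> [/chart_map_glue <- //|].
case: p q pz => [x g] [y g'] gz g'z; apply/toric_glueP => /=.
exists (torus_chart _ w0); split=> a sa.
  rewrite character_torus; first exact: (torus_chart_map _ _ zw).1 gz _ sa.
  exact: tangent_midpoint (svalP y) sa.
rewrite character_torus; first exact: (torus_chart_map _ _ zw).1 g'z _ sa.
by rewrite midpointC; exact: tangent_midpoint (svalP x) sa.
Qed.

Definition big_torus : set Y := [set y | forall j, std_chart fh j y].

Lemma big_torusE z : big_torus (h z) <-> forall j, sval z j != 0.
Proof. by split=> hz j; have := hz j; move/(std_chartE fh h_eq). Qed.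

Lemma zopen_big_torus : zopen big_torus.
Proof.
have [_ go _] := fh; apply: go.
have -> : h @^-1` big_torus
    = setT `&` [set z | \prod_j sval z j != 0].
  apply/seteqP; split=> [z /big_torusE hz|z [_ /prodf_neq0 hz]].
    by split=> //; apply/prodf_neq0 => j _.
  by apply/big_torusE => j; exact: hz.
apply: regular_unit; apply: regular_prod => [|j]; first exact: zopenT.
exact: regular_homog_coord.
Qed.

Lemma dense_big_torus : dense_open big_torus.
Proof.
have [x Px] := P0; have [v _] := domP Px.
split=> [|U oU U0]; first exact: zopen_big_torus.
have [_ irr] : irreducible Y.
  exact: (projective_irreducible mh fh (leq_ltn_trans _ (ltn_ord (e' v)))).
apply: irr => //; first exact: zopen_big_torus.
have z1 : punctured C N (fun=> 1) by exists (e' v); rewrite oner_neq0.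
by exists (h (exist _ _ z1)); apply/big_torusE => j; rewrite oner_neq0.
Qed.

Lemma toric_birational :
  exists f : toric_variety P -> Y, birational_morphism f.
Proof.
have [f [[mf fE] _]] := quotient_universal toric_glue_refl
  morphism_chart_map chart_map_glue.
have fp p : f (proj (@toric_glue R V P) p) = chart_map p by rewrite -fE.
exists f; split=> //; exists (f @^-1` big_torus), big_torus.
have [x0 Px0] := P0; have [v0 _] := domP Px0.
split; last 2 first.
- exact: dense_big_torus.
- pose hU (u : subspace (f @^-1` big_torus)) : subspace big_torus :=
    exist _ (f (sval u)) (svalP u).
  have wT (y : subspace big_torus) i : ratio fh (e' i) (e' v0) (sval y) != 0.
    by rewrite mulf_neq0 ?invr_eq0 //; exact: (svalP y).
  pose x0' : {x | P x} := exist _ x0 Px0.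
  pose pt0 (y : subspace big_torus) : toric_charts P :=
    existT _ x0' (torus_chart x0 (wT y)).
  have zy (y : subspace big_torus) : punctured C N
      ((fun i => ratio fh (e' i) (e' v0) (sval y)) \o e).
    by exists (e' v0) => /=; exact: wT.
  pose z (y : subspace big_torus) : subspace (punctured C N) :=
    exist _ _ (zy y).
  have hz (y : subspace big_torus) : h (z y) = sval y.
    rewrite -[RHS](homog_reprK fh); apply/h_eq.
    exists (sval (homog_repr fh (sval y)) (e' v0)); first exact: (svalP y).
    apply/funext => j /=; rewrite eK /ratio mulrC divfK //; exact: (svalP y).
  have cpt0 (y : subspace big_torus) : chart_map (pt0 y) = sval y.
    rewrite -hz; apply/(torus_chart_map (wT y)) => // a.
    exact: character_torus.
  have inU (y : subspace big_torus) : (f @^-1` big_torus) (proj (@toric_glue R V P) (pt0 y)).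
    by rewrite /= fp cpt0; exact: (svalP y).
  pose psi (y : subspace big_torus) : subspace (f @^-1` big_torus) :=
    exist _ _ (inU y).
  exists hU => //; split; last (exists psi; split).
  + apply: morphism_to_subspace; apply: morphism_comp mf.
    exact: morphism_sval.
  + have m0 : morphism (fun y : subspace big_torus => torus_chart x0 (wT y)).
      apply: morphism_to_subspace; apply: morphism_to_affine => a /=.
      have [_ ms] := @morphism_sval _ _ big_torus.
      have ra i : @regular _ (subspace big_torus) setT
          (fun y : subspace big_torus => ratio fh (e' i) (e' v0) (sval y) ^ (sval a i)).
        apply: regular_exprz => [|u _]; last exact: wT.
        have := ms _ _ (regular_ratio fh h_eq (e' i) (e' v0)).
        move/regular_subset; apply; first exact: zopenT.
        by move=> u _; exact: (svalP u).
      have := regular_prod (zopenT _) ra; exact.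
    have m1 := morphism_comp m0 (@morphism_in_coproduct _ _
      (fun x : {x | P x} => toric_chart P (sval x)) x0').
    apply: morphism_to_subspace.
    exact: (morphism_comp m1 (morphism_proj (@toric_glue R V P))).
  + move=> u; apply: subspace_inj => /=.
    have [p pu] : exists p, proj (@toric_glue R V P) p = sval u.
      by have [s _ _] := final_proj (@toric_glue R V P); exact: s.
    rewrite -pu; apply/proj_eq/funext => q; apply/propext.
    have pz : chart_map p = h (z (hU u)) by rewrite hz /= -pu fp.
    rewrite (torus_class q (wT (hU u)) _ pz) //.
    by rewrite (torus_class q (wT (hU u)) (z := z (hU u))) // cpt0 hz.
  + move=> y; apply: subspace_inj => /=.
    by rewrite fp cpt0.
split=> [|O oO [A OA]]; first exact: mf.1 zopen_big_torus.
have [s _ _] := final_proj (@toric_glue R V P).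
have [[x g] pA] := s A; rewrite -pA in OA.
have [||w [w0 Ow]] := @torus_dense (sval x)
   [set g | O (proj (@toric_glue R V P) (existT _ x g))] (svalP x).
- exact: (oO x).
- by exists g.
exists (proj (@toric_glue R V P) (existT _ x (torus_chart (sval x) w0))).
split=> //=; rewrite fp /=; apply/big_torusE => j /=.
rewrite /simplex_coord character_torus; last exact: dominatingP.
exact: monomial_neq0.
Qed.

End ToricMorphism.

(** * Graph associahedra *)

Lemma exists_lower_bound (R : realFieldType) (T : finType) (f : T -> R) :
  (forall t, 0 < f t) -> exists2 e, 0 < e & forall t, e <= f t.
Proof.
move=> f0; pose s := \sum_t (f t)^-1.
have s0 : 0 <= s by apply: sumr_ge0 => t _; rewrite invr_ge0 ltW.
have s1 : 0 < 1 + s by rewrite ltr_wpDr.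
exists (1 + s)^-1 => [|t]; first by rewrite invr_gt0.
rewrite -[leRHS]invrK lef_pV2 ?posrE ?invr_gt0 //.
rewrite /s (bigD1 t) //= addrCA lerDl addr_ge0 //.
by apply: sumr_ge0 => u _; rewrite invr_ge0 ltW.
Qed.

Section GraphAssociahedron.
Variables (R : realType) (G : graph).
Local Notation h := (truncation_height R).
Local Notation PG := (@graph_associahedron R G).

Lemma truncation_height_lt m d : (0 < m)%N -> (0 < d)%N ->
  d.+1%:R * h m < h (m + d).
Proof.
move=> m0 d0; have m2 : (1 < m + d)%N by rewrite -addn1 leq_add.
rewrite /truncation_height leqNgt [(m + d <= 1)%N]leqNgt m2 /=.
case: (ltnP 1 m) => m1 /=; last by rewrite mulr0 exprn_gt0.
rewrite addnC -addnBA // exprD ltr_pM2r ?exprn_gt0 // -natrX ltr_nat.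
case: d d0 {m2} => // d _; elim: d => // d IHd.
rewrite expnS; apply: (@leq_ltn_trans (3 * d.+2)); last by rewrite ltn_mul2l.
by rewrite mulSn -addn1 leq_add2l.
Qed.

Lemma truncation_height_ge0 m : 0 <= h m.
Proof. by rewrite /truncation_height; case: ifP => // _; rewrite exprn_ge0. Qed.

Lemma graph_associahedron_convex : convex PG.
Proof.
move=> x y c d [[x0 sx] tx] [[y0 sy] ty] c0 d0 cd; split; first split.
- by move=> i; rewrite ffunE addr_ge0 // mulr_ge0.
- under eq_bigr do rewrite ffunE.
  by rewrite big_split -!mulr_sumr /= sx sy -mulrDl cd mul1r.
move=> t tt; under eq_bigr do rewrite ffunE.
rewrite big_split -!mulr_sumr /= -[leLHS]mul1r -cd mulrDl.
by apply: lerD; apply: ler_wpM2l => //; [exact: tx|exact: ty].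
Qed.

Lemma graph_associahedron_sum x : PG x -> \sum_i x i = h #|G|.
Proof. by case=> -[]. Qed.

Lemma graph_associahedron_nonempty : (0 < #|G|)%N -> PG !=set0.
Proof.
move=> G0; have G0R : 0 < #|G|%:R :> R by rewrite ltr0n.
exists [ffun=> h #|G| / #|G|%:R]; split; first split.
- by move=> i; rewrite ffunE divr_ge0 // truncation_height_ge0.
- under eq_bigr do rewrite ffunE.
  by rewrite sumr_const -[_ *+ _]mulr_natr divfK // gt_eqF.
move=> t /andP[/andP[t0 tG] _]; under eq_bigr do rewrite ffunE.
rewrite sumr_const -[_ *+ _]mulr_natl mulrA ler_pdivlMr //.
have d0 : (0 < #|G| - #|t|)%N by rewrite subn_gt0.
have := truncation_height_lt t0 d0; rewrite subnKC; last exact: ltnW.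
move=> /ltW lt; apply: le_trans (_ : #|t|%:R * ((#|G| - #|t|).+1%:R * h #|t|) <= _).
  rewrite mulrA mulrC ler_wpM2r ?truncation_height_ge0 // -natrM ler_nat.
  by rewrite -{1}(subnKC (ltnW tG)) mulnS leq_add2l leq_pmull.
by rewrite ler_wpM2l.
Qed.

Lemma max_slack x v t : PG x -> (forall i, x i <= x v) -> tube t -> v \in t ->
  h #|t| < \sum_(i in t) x i.
Proof.
move=> [[x0 sx] tx] xv tt vt; rewrite lt_neqAle tx // andbT; apply/eqP => ht.
have /andP[/andP[t0 tG] _] := tt.
have d0 : (0 < #|G| - #|t|)%N by rewrite subn_gt0.
have := truncation_height_lt t0 d0; rewrite subnKC; last exact: ltnW.
rewrite ltNge => /negP; apply; rewrite -sx (bigID (mem t)) /= -ht mulrS mulrDl mul1r lerD2l.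
have xt : x v <= h #|t|.
  rewrite ht (bigD1 v) //= lerDl; apply: sumr_ge0 => i _; exact: x0.
apply: le_trans (_ : \sum_(i | i \notin t) h #|t| <= _).
  by apply: ler_sum => i _; apply: le_trans xt.
rewrite sumr_const -[_ *+ _]mulr_natl ler_wpM2r ?truncation_height_ge0 // ler_nat.
have -> : #|[pred i | i \notin t]| = #|~: t|%SET by apply: eq_card => i;
  rewrite !inE.
by rewrite cardsCs finset.setCK.
Qed.

Lemma max_dominates x v : PG x -> (forall i, x i <= x v) -> dominates PG x v.
Proof.
move=> Px xv j; have [jv|jv] := eqVneq j v.
  rewrite jv edge_vectorxx; exact: tangent0.
have [[x0 sx] tx] := Px.
have G2 : (1 < #|G|)%N.
  rewrite (cardD1 v) (cardD1 j) !inE jv //.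
have xv0 : 0 < x v.
  have HG : 0 < h #|G|.
    by rewrite /truncation_height leqNgt G2 exprn_gt0.
  rewrite lt_neqAle x0 andbT; apply/eqP => xv0; move: HG; rewrite -sx.
  rewrite ltNge => /negP; apply; rewrite big1 // => i _.
  by apply/eqP; rewrite eq_le x0 andbT xv0.
pose f (t : {set G}) := if tube t && (v \in t) then \sum_(i in t) x i - h #|t| else x v.
have [t|e e0 ef] := @exists_lower_bound _ _ f.
  by rewrite /f; case: ifP => // /andP[tt vt];
    rewrite subr_gt0 (max_slack Px xv).
have sumE (t : {pred G}) : \sum_(i in t) [ffun i => x i + e * (edge_vector v j i)%:~R] i
    = \sum_(i in t) x i + e * ((j \in t)%:R - (v \in t)%:R).
  under eq_bigr do rewrite ffunE.
  rewrite big_split /= -mulr_sumr; congr (_ + _ * _).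
  under eq_bigr do rewrite ffunE rmorphB !rmorph_nat.
  have one u : \sum_(i in t) (i == u)%:R = (u \in t)%:R :> R.
    rewrite big_mkcond (bigD1 u) //= eqxx big1 ?addr0; first by case: ifP.
    by move=> i /negPf ->; rewrite if_same.
  by rewrite sumrB !one.
exists e => //; split; first split.
- move=> i; rewrite !ffunE rmorphB !rmorph_nat.
  have [->|iv] := eqVneq i v.
    have := ef finset.set0; rewrite /f finset.in_set0 andbF => ev.
    by rewrite eq_sym (negPf jv) sub0r mulrN mulr1 subr_ge0.
  by rewrite subr0 addr_ge0 // mulr_ge0 // ltW.
- by have := sumE predT; rewrite /= => ->; rewrite subrr mulr0 addr0.
move=> t tt; rewrite sumE; have [vt|vt] := boolP (v \in t); last first.
  by rewrite subr0 (le_trans (tx t tt)) // lerDl mulr_ge0 // ltW.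
have := ef t; rewrite /f tt vt /= => et.
case: (j \in t); first by rewrite subrr mulr0 addr0 tx.
by rewrite sub0r mulrN mulr1 lerBrDr -lerBrDl.
Qed.

Lemma graph_associahedron_dominated x : (0 < #|G|)%N -> PG x ->
  exists v, dominates PG x v.
Proof.
move=> /card_gt0P[v0 _] Px.
exists [arg max_(v > v0) x v]%O; apply: max_dominates => // i.
by case: arg_maxP => // v _; apply.
Qed.

End GraphAssociahedron.

(** * Normal forms of frames *)

Lemma det_mx2 (K : comRingType) (M : 'M[K]_2) :
  \det M = M 0 0 * M 1 1 - M 0 1 * M 1 0.
Proof.
rewrite (expand_det_row _ 0) !big_ord_recl big_ord0 addr0 /cofactor !det_mx11.
rewrite !mxE /= expr0 expr1 mul1r mulN1r mulrN.
by congr (M _ _ * M _ _ - M _ _ * M _ _); exact: val_inj.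
Qed.

Section PluckerIdentities.
Variable K : comRingType.

Lemma plucker_mul_identity (a b c d x y x' y' t t' : K) :
  ((a * x + b * y) * t) * ((c * x' + d * y') * t')
    - ((a * x' + b * y') * t') * ((c * x + d * y) * t)
  = (a * d - b * c) * (x * y' - x' * y) * t * t'.
Proof. by ring. Qed.

Lemma plucker_relation_identity (a b c d a' b' c' d' : K) :
  (a * b' - b * a') * (c * d' - d * c') - (a * c' - c * a') * (b * d' - d * b')
    + (a * d' - d * a') * (b * c' - c * b') = 0.
Proof. by ring. Qed.

End PluckerIdentities.

Section Frames.
Variables (R : realType) (n : nat).
Local Notation C := R[i].
Implicit Types A B : 'M[C]_(2, n).

Lemma pluckerE A i j : plucker A i j = A 0 i * A 1 j - A 0 j * A 1 i.
Proof.
rewrite /plucker det_mx2 !mxE.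
by rewrite !(tnth_nth i).
Qed.

Lemma plucker_anti A i j : plucker A j i = - plucker A i j.
Proof. by rewrite !pluckerE opprB. Qed.

Lemma plucker_ii A i : plucker A i i = 0.
Proof. by rewrite pluckerE subrr. Qed.

Lemma pluckerM (M : 'M[C]_2) A (t : 'rV[C]_n) i j :
  plucker (M *m A *m diag_mx t) i j = \det M * plucker A i j * t 0 i * t 0 j.
Proof.
rewrite !pluckerE det_mx2 !mul_mx_diag !mxE !big_ord_recl !big_ord0 !addr0.
have -> : lift ord0 ord0 = 1 :> 'I_2 by exact: val_inj.
exact: plucker_mul_identity.
Qed.

Lemma plucker_relation A i j k l :
  plucker A i j * plucker A k l - plucker A i k * plucker A j l
    + plucker A i l * plucker A j k = 0.
Proof. by rewrite !pluckerE plucker_relation_identity. Qed.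

Definition frame_equiv A B : Prop :=
  exists (M : 'M[C]_2) (t : 'rV[C]_n),
    [/\ M \in unitmx, forall i, t 0 i != 0 & B = M *m A *m diag_mx t].

Lemma frame_equiv_sym A B : frame_equiv A B -> frame_equiv B A.
Proof.
move=> [M [t [uM t0 ->]]]; exists (invmx M), (\row_i (t 0 i)^-1).
split=> [|i|]; first by rewrite unitmx_inv.
  by rewrite mxE invr_eq0.
rewrite !mulmxA mulVmx // mul1mx -mulmxA; apply/matrixP => i j.
rewrite -[RHS]/((A *m (diag_mx t *m diag_mx _)) i j).
rewrite mulmx_diag mul_mx_diag !mxE divff ?mulr1 //.
Qed.

Lemma frame_equiv_trans A B D :
  frame_equiv A B -> frame_equiv B D -> frame_equiv A D.
Proof.
move=> [M [t [uM t0 ->]]] [M' [t' [uM' t0' ->]]].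
exists (M' *m M), (\row_i (t 0 i * t' 0 i)); split=> [|i|].
- by rewrite unitmx_mul uM' uM.
- by rewrite mxE mulf_neq0.
by rewrite -mulmx_diag !mulmxA.
Qed.

Lemma frame_equivMl (M : 'M[C]_2) A : M \in unitmx -> frame_equiv A (M *m A).
Proof.
move=> uM; exists M, (const_mx 1); split=> // [i|].
  by rewrite mxE oner_neq0.
by rewrite diag_const_mx mulmx1.
Qed.

Lemma frame_equiv_plucker A B i j :
  frame_equiv A B -> (plucker B i j == 0) = (plucker A i j == 0).
Proof.
move=> [M [t [uM t0 ->]]]; rewrite pluckerM !mulf_eq0 !(negPf (t0 _)) !orbF.
by move: uM; rewrite unitmxE unitfE => /negPf ->.
Qed.

Lemma plucker_rank A i j : plucker A i j != 0 -> \rank A = 2%N.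
Proof.
move=> p0; apply/eqP; rewrite eqn_leq rank_leq_row /=.
move: p0; rewrite /plucker; move: (tnth [tuple i; j]) => s p0.
pose B := A *m (\matrix_(a, b) (a == s b)%:R).
have BE : B = colsub s A.
  apply/matrixP => a b; rewrite !mxE (bigD1 (s b)) //= !mxE.
  rewrite eqxx mulr1 big1 ?addr0 // => c /negPf cb; by rewrite !mxE cb mulr0.
have uB : B \in unitmx by rewrite unitmxE BE unitfE.
have := mxrankM_maxl A (\matrix_(a, b) (a == s b)%:R); rewrite -/B.
by rewrite (mxrank_unit uB).
Qed.

Definition support A : {set {set 'I_n}} :=
  [set I : {set 'I_n} | (#|I| == 2%N) &&
    [forall i in I, forall j in I, (i != j) ==> (plucker A i j != 0)]]%SET.

Lemma in_support A i j : i != j ->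
  ([set i; j]%SET \in support A) = (plucker A i j != 0).
Proof.
move=> ij; rewrite inE cards2 ij /=; apply/forall_inP/idP => [h|pij k].
  have /forall_inP/(_ j) := h i (set21 i j).
  by rewrite set22 ij; apply.
rewrite !inE => /orP[]/eqP->; apply/forall_inP => l; rewrite !inE;
  move=> /orP[]/eqP->; rewrite ?eqxx ?pij ?implybT //.
by rewrite plucker_anti oppr_eq0 pij implybT.
Qed.

Lemma exists_stiefel A : \rank A = 2%N -> exists a : stiefel R n, frame a = A.
Proof.
move=> rA; have e : to_matrix (fun p => A p.1 p.2) = A.
  by apply/matrixP => i j; rewrite mxE.
by exists (exist _ (fun p => A p.1 p.2) (etrans (congr1 _ e) rA)).
Qed.

Lemma row_spaceP (a b : stiefel R n) : row_space a = row_space b <->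
  exists2 M : 'M[C]_2, M \in unitmx & frame b = M *m frame a.
Proof.
rewrite /row_space proj_eq; split=> [ab|[M uM e]].
  have : same_row_space a b by rewrite ab /same_row_space submx_refl.
  move=> /andP[_ /submxP[M e]]; exists M => //.
  rewrite -row_full_unit /row_full eqn_leq rank_leq_row /=.
  by have := mxrankM_maxl M (frame a); rewrite -e (svalP b).
apply/funext => c; rewrite /same_row_space.
have ab : (frame a :=: frame b)%MS.
  by rewrite e; apply/eqmx_sym/eqmxMfull; rewrite row_full_unit.
by rewrite !ab.
Qed.

Lemma row_space_equiv (a b : stiefel R n) :
  row_space a = row_space b -> frame_equiv (frame a) (frame b).
Proof. by move=> /row_spaceP[M uM ->]; exact: frame_equivMl. Qed.

Lemma stratum_support (a : stiefel R n) :
  stratum (support (frame a)) (row_space a).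
Proof.
exists a => // i j ij; rewrite in_support //.
by apply: contraTneq ij => ->; rewrite ltnn.
Qed.

Lemma admissible_support A i j :
  plucker A i j != 0 -> admissible R (support A).
Proof.
move=> /plucker_rank /exists_stiefel[a <-]; split=> [I|].
  by rewrite inE => /andP[/eqP].
by exists (row_space a); exact: stratum_support.
Qed.

End Frames.

Lemma moduli_identity (K : fieldType) (d p q t0 t1 t : K) :
  d != 0 -> q != 0 -> t0 != 0 -> t != 0 ->
  d * p * t1 * t / (d * q * t * t0) = t1 / t0 * (p / q).
Proof. by move=> *; field; apply/and4P. Qed.

Lemma mul_mx_diagE (K : comRingType) m n (B : 'M[K]_(m, n)) (t : 'rV[K]_n) i j :
  (B *m diag_mx t) i j = B i j * t 0 j.
Proof. by rewrite mul_mx_diag mxE. Qed.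

Section NormalForm.
Variables (R : realType) (N : nat).
Local Notation C := R[i].
Implicit Types A B : 'M[C]_(2, N.+2).

Definition col0 : 'I_N.+2 := ord0.
Definition col1 : 'I_N.+2 := lift ord0 ord0.
Definition colS (j : 'I_N) : 'I_N.+2 := lift ord0 (lift ord0 j).

Lemma split_ord0 n (i : 'I_n.+1) : (exists j, i = lift ord0 j) \/ i = ord0.
Proof. by case: (unliftP ord0 i) => [j ->|->]; [left; exists j|right]. Qed.

Lemma ord2P (i : 'I_2) : {i = 0} + {i = 1}.
Proof.
by case: i => [[|[|m]] lt] //; [left|right]; exact: val_inj.
Qed.

Lemma colP (P : 'I_N.+2 -> Prop) :
  P col0 -> P col1 -> (forall j, P (colS j)) -> forall i, P i.
Proof.
move=> P0 P1 PS i; have [[i' ->]|->] := split_ord0 i; last exact: P0.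
by have [[j ->]|->] := split_ord0 i'; [exact: PS|exact: P1].
Qed.

Definition normal_frame (z : 'I_N -> C) : 'M[C]_(2, N.+2) :=
  \matrix_(i, j) if unlift ord0 j is Some j' then
      if unlift ord0 j' is Some k then (if i == 0 then 1 else z k)
      else (i == 0)%:R
    else (i == 1)%:R.

Lemma normal_frame0 z i : normal_frame z i col0 = (i == 1)%:R.
Proof. by rewrite mxE unlift_none. Qed.

Lemma normal_frame1 z i : normal_frame z i col1 = (i == 0)%:R.
Proof. by rewrite mxE liftK unlift_none. Qed.

Lemma normal_frameS z i j :
  normal_frame z i (colS j) = if i == 0 then 1 else z j.
Proof. by rewrite mxE !liftK. Qed.

Definition nfE := (normal_frame0, normal_frame1, normal_frameS).

Definition moduli A (j : 'I_N) : C :=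
  plucker A col1 (colS j) / plucker A (colS j) col0.

Lemma moduli_normal_frame z : moduli (normal_frame z) = z.
Proof.
apply/funext => j; rewrite /moduli !pluckerE !nfE /=.
by rewrite !(mul1r, mulr0, mul0r) !subr0 divr1.
Qed.

(* The first condition makes the columns nonzero, so the second one says that *)
(* the columns other than [col0] are not all parallel.                        *)
Definition stable A : Prop :=
  (forall j, j != col0 -> plucker A col0 j != 0) /\
  exists k, plucker A col1 (colS k) != 0.

Lemma stable_equiv A B : frame_equiv A B -> stable A -> stable B.
Proof.
move=> AB [sA [k Ak]]; split=> [j j0|].
  by rewrite (frame_equiv_plucker _ _ AB) sA.
by exists k; rewrite (frame_equiv_plucker _ _ AB).
Qed.

Lemma stable_normal_frame z : (exists j, z j != 0) -> stable (normal_frame z).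
Proof.
move=> [k zk]; split.
  by apply: colP => [|_|j _]; rewrite ?eqxx // pluckerE !nfE /=
    !(mul1r, mulr0, mul0r) sub0r oppr_eq0 oner_neq0.
by exists k; rewrite pluckerE !nfE /= !mul1r subr0.
Qed.

Lemma stable_col0r A j : stable A -> j != col0 -> plucker A j col0 != 0.
Proof. by move=> [sA _] j0; rewrite plucker_anti oppr_eq0 sA. Qed.

Lemma moduli_neq0 A : stable A -> exists j, moduli A j != 0.
Proof.
move=> sA; have [_ [k Ak]] := sA; exists k.
by rewrite mulf_neq0 // invr_neq0 // stable_col0r.
Qed.

Lemma stable_pair A (i j : 'I_N.+2) :
  (forall j, j != col0 -> plucker A col0 j != 0) ->
  i != col0 -> j != col0 -> plucker A i j != 0 -> stable A.
Proof.
move=> sA i0 j0 Aij; split=> //.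
have h l : l != col0 -> plucker A col1 l != 0 ->
    exists k, plucker A col1 (colS k) != 0.
  move: l; apply: colP => // [_|k _ ?]; last by exists k.
  by rewrite plucker_ii eqxx.
have [A1j|] := eqVneq (plucker A col1 j) 0; last exact: h.
have [A1i|] := eqVneq (plucker A col1 i) 0; last exact: h.
have := plucker_relation A col0 col1 i j.
rewrite A1j A1i !mulr0 subr0 addr0 => /eqP.
by rewrite mulf_eq0 (negPf (sA _ _)) // (negPf Aij).
Qed.

Lemma moduli_equiv A B : stable A -> frame_equiv A B ->
  exists2 c, c != 0 & moduli B = fun j => c * moduli A j.
Proof.
move=> sA [M [t [uM t0 ->]]]; exists (t 0 col1 / t 0 col0).
  by rewrite mulf_neq0 ?invr_neq0.
have d0 : \det M != 0 by move: uM; rewrite unitmxE unitfE.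
apply/funext => j; rewrite /moduli !pluckerM.
have := stable_col0r sA (_ : colS j != col0).
by move=> /(_ isT) ?; rewrite moduli_identity.
Qed.

Lemma equiv_normal_frame A :
  stable A -> frame_equiv A (normal_frame (moduli A)).
Proof.
move=> sA; have A10 : plucker A col1 col0 != 0 by rewrite stable_col0r.
have AS0 j : plucker A (colS j) col0 != 0 by rewrite stable_col0r.
pose M : 'M[C]_2 := \matrix_(i, j)
  if i == 0 then (if j == 0 then A 1 col0 else - A 0 col0)
  else (if j == 0 then - A 1 col1 else A 0 col1).
have M0E k : M 0 0 * A 0 k + M 0 1 * A 1 k = plucker A k col0.
  by rewrite !mxE /= pluckerE [A 1 col0 * _]mulrC mulNr.
have M1E k : M 1 0 * A 0 k + M 1 1 * A 1 k = plucker A col1 k.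
  by rewrite !mxE /= pluckerE mulNr addrC [A 1 col1 * _]mulrC.
have dM : \det M = plucker A col1 col0.
  by rewrite det_mx2 -M0E !mxE /= mulrN opprK.
exists M, (\row_j (if j == col0 then (plucker A col1 col0)^-1
                   else (plucker A j col0)^-1)); split=> [|j|].
- by rewrite unitmxE unitfE dM.
- rewrite mxE; case: ifPn => j0; first by rewrite invr_eq0.
  by rewrite invr_eq0 stable_col0r.
apply/matrixP => i j; rewrite mul_mx_diagE [X in _ * X]mxE.
have -> : (M *m A) i j = if i == 0 then plucker A j col0 else plucker A col1 j.
  rewrite mxE !big_ord_recl big_ord0 addr0.
  have -> : lift ord0 ord0 = 1 :> 'I_2 by exact: val_inj.
  by rewrite -M0E -M1E; case: (ord2P i) => ->.
move: j; apply: colP => [||j].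
- rewrite nfE plucker_ii; case: (ord2P i) => -> /=; first by rewrite mul0r.
  by rewrite divff.
- rewrite nfE plucker_ii; case: (ord2P i) => -> /=; last by rewrite mul0r.
  by rewrite divff.
- rewrite nfE; case: (ord2P i) => -> //=; by rewrite divff.
Qed.

Lemma normal_frame_scale z (c : C) : c != 0 ->
  frame_equiv (normal_frame z) (normal_frame (fun j => c * z j)).
Proof.
move=> c0; exists (\matrix_(i, j) ((i == j)%:R * (if i == 0 then 1 else c))),
  (\row_j (if j == col0 then c^-1 else 1)); split=> [|j|].
- by rewrite unitmxE unitfE det_mx2 !mxE /= !(mul1r, mul0r) subr0.
- by rewrite mxE; case: ifP => _; rewrite ?invr_eq0 ?oner_neq0.
apply/matrixP => i j; rewrite mul_mx_diagE [X in _ * X]mxE.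
rewrite [X in _ = X * _]mxE !big_ord_recl big_ord0 addr0.
have -> : lift ord0 ord0 = 1 :> 'I_2 by exact: val_inj.
rewrite ![(\matrix_(_, _) (_ * _)) _ _]mxE.
move: j; apply: colP => [||j]; rewrite !nfE; case: (ord2P i) => -> /=;
  rewrite ?(mul0r, mulr0, mul1r, mulr1, add0r, addr0) //.
by rewrite divff.
Qed.

Lemma frame_equiv_moduli A B : stable A -> stable B ->
  frame_equiv A B <->
  exists2 c, c != 0 & moduli B = fun j => c * moduli A j.
Proof.
move=> sA sB; split; first exact: moduli_equiv.
move=> [c c0 BA]; apply: frame_equiv_trans (equiv_normal_frame sA) _.
apply: frame_equiv_trans (normal_frame_scale _ c0) _; rewrite -BA.
exact/frame_equiv_sym/equiv_normal_frame.
Qed.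

End NormalForm.

(** * The space of parameters *)

Section ProjectiveChamber.
Variables (R : realType) (N : nat).
Local Notation C := R[i].
Local Notation col0 := (col0 N).
Local Notation col1 := (col1 N).

Definition omega : {set {set {set 'I_N.+2}}} :=
  [set s : {set {set 'I_N.+2}} | [&& `[< admissible R s >],
    [forall i, (i != col0) ==> ([set col0; i] \in s)] &
    [exists i, exists j,
      [&& i != col0, j != col0, i != j & [set i; j] \in s]]]]%SET.

Lemma in_omega (s : {set {set 'I_N.+2}}) : s \in omega <-> [/\ admissible R s,
  forall i, i != col0 -> [set col0; i]%SET \in s &
  exists i j, [/\ i != col0, j != col0, i != j & [set i; j]%SET \in s]].
Proof.
rewrite inE; split=> [/and3P[/asboolP ads /forall_inP h0 /existsP[i /existsP[j /and4P h]]]|].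
  by split=> //; exists i, j; case: h.
move=> [ads h0 [i [j [i0 j0 ij sij]]]]; apply/and3P; split.
- exact/asboolP.
- exact/forall_inP.
by apply/existsP; exists i; apply/existsP; exists j; apply/and4P.
Qed.

Lemma stratum_plucker (s : {set {set 'I_N.+2}}) (a : stiefel R N.+2) i j :
  (forall i j : 'I_N.+2, (i < j)%N ->
    plucker (frame a) i j != 0 <-> ([set i; j]%SET \in s)) ->
  i != j -> (plucker (frame a) i j != 0) = ([set i; j]%SET \in s).
Proof.
move=> sa ij; apply/idP/idP; move: ij; rewrite neq_ltn => /orP[] ij.
- by move/(sa i j ij).
- by rewrite plucker_anti oppr_eq0 finset.setUC => /(sa j i ij).
- by move/(sa i j ij).
- by rewrite plucker_anti oppr_eq0 finset.setUC => /(sa j i ij).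
Qed.

Lemma strata_stable (a : stiefel R N.+2) :
  (exists2 s, s \in omega & stratum s (row_space a)) <-> stable (frame a).
Proof.
split=> [[s /in_omega[_ s0 [i [j [i0 j0 ij sij]]]] [b ab sb]]|].
  apply: stable_equiv (frame_equiv_sym (row_space_equiv ab)) _.
  have h := stratum_plucker sb.
  apply: (@stable_pair _ _ _ i j) => // [k k0|]; last by rewrite h.
  by rewrite h ?s0 // eq_sym.
move=> sa; have [p0 [k pk]] := sa.
exists (support (frame a)); last exact: stratum_support.
apply/in_omega; split=> [|i i0|].
- exact: admissible_support pk.
- by rewrite in_support ?p0 // eq_sym.
- exists col1, (colS k); rewrite in_support //.
Qed.

Let Y := space_of_parameters R omega.
Let SU := strata_union R omega.

Definition stable_frames : set (stiefel R N.+2) := [set a | stable (frame a)].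

Lemma stable_strata (a : subspace stable_frames) :
  [set L : grassmannian R N.+2 | exists2 s, s \in omega & stratum s L]
    (row_space (sval a)).
Proof. by apply/strata_stable; exact: (svalP a). Qed.

Definition stable_row_space (a : subspace stable_frames) : SU :=
  exist _ (row_space (sval a)) (stable_strata a).

Lemma regular_plucker i j :
  @regular _ (stiefel R N.+2) setT (fun a => plucker (frame a) i j).
Proof.
have rx k l : @regular _ (stiefel R N.+2) setT (fun a => frame a k l).
  have [_ h] := @morphism_sval _ (affine_space C ('I_2 * 'I_N.+2)%type)
    [set a | \rank (to_matrix a) = 2%N].
  have := h _ _ (regular_polyfun (@polyfun_coord C _ (k, l))).
  by apply: regular_ext => a _ /=; rewrite /frame mxE.
apply: (regular_ext (f := fun a => frame a 0 i * frame a 1 j - frame a 0 j * frame a 1 i)).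
  by move=> a _; rewrite pluckerE.
by apply: regularB; exact: regularM.
Qed.

Lemma zopen_stable_frames : zopen stable_frames.
Proof.
have rp : @regular _ (stiefel R N.+2) setT
    (fun a => \prod_j plucker (frame a) col0 (lift ord0 j)).
  by apply: regular_prod => [|j]; [exact: zopenT | exact: regular_plucker].
apply: zopen_local => a [p0 [k pk]].
exists (setT `&` [set b | plucker (frame b) col1 (colS k)
    * (\prod_j plucker (frame b) col0 (lift ord0 j)) != 0]); split.
- exact: regular_unit (regularM (regular_plucker _ _) rp).
- split=> //=; rewrite mulf_neq0 //; apply/prodf_neq0 => j _.
  exact: p0.
move=> b [_ /=]; rewrite mulf_eq0 negb_or => /andP[bk /prodf_neq0 b0].
split=> [j j0|]; last by exists k.
have [[i ji]|jE] := split_ord0 j; last by case/eqP: j0; exact: jE.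
by rewrite ji; exact: (b0 i isT).
Qed.

Lemma final_stable_row_space : final stable_row_space.
Proof.
apply: (@final_restrict _ _ _ (@row_space R N.+2)).
- exact: final_proj.
- exact: zopen_stable_frames.
- by apply/seteqP; split=> a /strata_stable.
- by [].
Qed.

Lemma torus_orbitP (a b : subspace stable_frames) :
  torus_orbit (stable_row_space a) (stable_row_space b) <->
  frame_equiv (frame (sval a)) (frame (sval b)).
Proof.
split=> [[t [t0 [a' [b' [/= ea eb e]]]]]|[M [t [uM t0 e]]]].
  apply: frame_equiv_trans (row_space_equiv ea) _.
  apply: (@frame_equiv_trans _ _ _ (frame b')); last first.
    exact/frame_equiv_sym/row_space_equiv.
  by exists 1%:M, t; rewrite unitmx1 mul1mx.
have rD : \rank (frame (sval a) *m diag_mx t) = 2%N.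
  apply: etrans (svalP (sval b) : \rank (frame (sval b)) = 2%N).
  have fM : row_full M by rewrite row_full_unit.
  by rewrite e -mulmxA (eqmxMfull _ fM).
have [b' eb'] := exists_stiefel rD.
exists t; split=> //; exists (sval a), b'; split=> //=.
by apply/esym/row_spaceP; exists M => //; rewrite eb' e mulmxA.
Qed.

Local Notation punctured := (punctured C N).

Definition parameter (a : subspace stable_frames) : Y :=
  proj (@torus_orbit R N.+2 omega) (stable_row_space a).

Lemma parameter_eq a b : parameter a = parameter b <->
  exists2 c, c != 0 & moduli (frame (sval b)) = fun j => c * moduli (frame (sval a)) j.
Proof.
rewrite -frame_equiv_moduli; [|exact: (svalP a)|exact: (svalP b)].
rewrite /parameter proj_eq; split=> [e|ab].
  apply/torus_orbitP; rewrite e; apply/torus_orbitP.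
  by have := frame_equivMl (frame (sval b)) (unitmx1 _ 2); rewrite mul1mx.
apply/funext => L; have [sL _ _] := final_stable_row_space.
have [d <-] := sL L; apply/propext; rewrite !torus_orbitP.
split; first exact/frame_equiv_trans/frame_equiv_sym.
exact: frame_equiv_trans.
Qed.

Lemma stiefel_normal_frame (z : affine_space C 'I_N) :
  \rank (to_matrix (fun p => normal_frame z p.1 p.2)) = 2%N.
Proof.
apply: (@plucker_rank _ _ _ col1 col0).
rewrite pluckerE !mxE !unlift_none !liftK !unlift_none /=.
by rewrite mulr1 mulr0 subr0 oner_neq0.
Qed.

Definition normal_stiefel (z : affine_space C 'I_N) : stiefel R N.+2 :=
  exist _ (fun p => normal_frame z p.1 p.2) (stiefel_normal_frame z).

Lemma frame_normal_stiefel z : frame (normal_stiefel z) = normal_frame z.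
Proof. by apply/matrixP => i j; rewrite mxE. Qed.

Lemma stable_normal_stiefel (z : subspace punctured) :
  stable_frames (normal_stiefel (sval z)).
Proof.
rewrite /stable_frames /= frame_normal_stiefel.
exact: stable_normal_frame (svalP z).
Qed.

Definition stable_normal (z : subspace punctured) : subspace stable_frames :=
  exist _ (normal_stiefel (sval z)) (stable_normal_stiefel z).

Definition homog (z : subspace punctured) : Y := parameter (stable_normal z).

Lemma homog_eq z w : homog z = homog w <->
  exists2 c, c != 0 & sval w = fun j => c * sval z j.
Proof.
by rewrite /homog parameter_eq /= !frame_normal_stiefel !moduli_normal_frame.
Qed.

Lemma morphism_homog : morphism homog.
Proof.
have m1 : morphism (fun z : subspace punctured => normal_stiefel (sval z)).
  apply: morphism_to_subspace; apply: morphism_to_affine => -[i j] /=.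
  have [_ ms] := @morphism_sval _ _ punctured.
  have rz k : @regular _ (subspace punctured) setT (fun z => sval z k).
    have := ms _ _ (regular_polyfun (@polyfun_coord C 'I_N k)); exact.
  have rc (c : C) : @regular _ (subspace punctured) setT (fun=> c).
    exact/regular_cst/zopenT.
  move: j; apply: colP => [||j].
  - apply: regular_ext (rc (i == 1)%:R) => z _.
    by rewrite nfE.
  - apply: regular_ext (rc (i == 0)%:R) => z _.
    by rewrite nfE.
  case: (ord2P i) => ->.
  - apply: regular_ext (rc 1) => z _.
    by rewrite nfE.
  apply: regular_ext (rz j) => z _ /=.
  by rewrite nfE.
have m2 : morphism (fun z : subspace punctured => stable_row_space (stable_normal z)).
  apply: morphism_to_subspace.
  exact: morphism_comp m1 (morphism_proj (@same_row_space R N.+2)).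
exact: morphism_comp m2 (morphism_proj _).
Qed.

Lemma final_homog : final homog.
Proof.
pose g (a : subspace stable_frames) : subspace punctured :=
  exist _ (moduli (frame (sval a))) (moduli_neq0 (svalP a)).
have gm : morphism g.
  apply: morphism_to_subspace; apply: morphism_to_affine => j /=.
  have [_ ms] := @morphism_sval _ _ stable_frames.
  have rp k l : @regular _ (subspace stable_frames) setT
      (fun a => plucker (frame (sval a)) k l).
    by have := ms _ _ (regular_plucker k l); exact.
  apply: (regular_div (rp col1 (colS j)) (rp (colS j) col0)) => a _.
  exact: stable_col0r (svalP a) _.
apply: (final_factor gm).
have -> : homog \o g = parameter.
  apply/funext => a; rewrite /= /homog parameter_eq; exists 1;
    first exact: oner_neq0.
  have -> : frame (sval (stable_normal (g a))) = normal_frame (sval (g a)).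
    exact: frame_normal_stiefel.
  rewrite moduli_normal_frame.
  by apply/funext => j; rewrite mul1r.
exact: final_comp final_stable_row_space (final_proj _).
Qed.

End ProjectiveChamber.

(** * The chamber *)

Section ConvexHulls.
Variables (R : realType) (V : finType).
Implicit Types (S : set {ffun V -> R}) (x y : {ffun V -> R}) (l : V -> R).

Lemma linear_combination m (c : 'I_m -> R) (p : 'I_m -> {ffun V -> R}) l :
  \sum_i l i * [ffun v => \sum_k c k * p k v] i
  = \sum_k c k * \sum_i l i * p k i.
Proof.
under eq_bigr do rewrite ffunE mulr_sumr.
rewrite exchange_big; apply: eq_bigr => k _; rewrite mulr_sumr.
by apply: eq_bigr => i _; rewrite mulrCA.
Qed.

Lemma convex_hull_ge S l c y : (forall p, S p -> c <= \sum_i l i * p i) ->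
  convex_hull S y -> c <= \sum_i l i * y i.
Proof.
move=> Sc [m [d [p [Sp d0 d1 ->]]]]; rewrite linear_combination.
rewrite -[leLHS]mul1r -d1 mulr_suml; apply: ler_sum => k _.
by rewrite ler_wpM2l // Sc.
Qed.

Lemma affine_hull_eq S l c y : (forall p, S p -> \sum_i l i * p i = c) ->
  affine_hull S y -> \sum_i l i * y i = c.
Proof.
move=> Sc [m [d [p [Sp d1 ->]]]]; rewrite linear_combination.
by under eq_bigr do rewrite Sc //; rewrite -mulr_suml d1 mul1r.
Qed.

Lemma affine_hull_ray S y p (c : R) : convex_hull S y -> S p ->
  affine_hull (convex_hull S) [ffun i => y i + c * (y i - p i)].
Proof.
move=> Sy Sp; pose q (k : 'I_2) := if k == 0 then y else p.
pose d (k : 'I_2) := if k == 0 then 1 + c else - c.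
have Sp' : convex_hull S p.
  exists 1%N, (fun=> 1), (fun=> p); split=> // [|]; first by rewrite big_ord1.
  by apply/ffunP => i; rewrite ffunE big_ord1 mul1r.
exists 2%N, d, q; split=> [k||].
- by rewrite /q; case: ifP.
- by rewrite !big_ord_recl big_ord0 /d /= addr0 addrK.
by apply/ffunP => i; rewrite !ffunE !big_ord_recl big_ord0 /d /q /=; ring.
Qed.

Lemma relative_interior_gt S l c y p :
  (forall p, S p -> c <= \sum_i l i * p i) ->
  S p -> c < \sum_i l i * p i -> relative_interior (convex_hull S) y ->
  c < \sum_i l i * y i.
Proof.
move=> Sc Sp cp [Sy [e e0 ye]]; rewrite ltNge; apply/negP => yc.
have [i|d d0 de] := @exists_lower_bound R V (fun i => e / 2 / (1 + `|y i - p i|)).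
  by rewrite divr_gt0 ?divr_gt0 // ltr_pwDl.
have /(convex_hull_ge Sc) : convex_hull S [ffun i => y i + d * (y i - p i)].
  apply: ye; first exact: affine_hull_ray Sy Sp.
  move=> i; rewrite ffunE addrAC subrr add0r normrM gtr0_norm //.
  have n0 : 0 < 1 + `|y i - p i| by rewrite ltr_pwDl.
  apply: le_lt_trans (_ : d * (1 + `|y i - p i|) < e).
    by rewrite ler_pM2l // lerDr.
  apply: le_lt_trans (_ : e / 2 < e);
    last by rewrite ltr_pdivrMr // mulr_natr mulr2n ltrDl.
  by rewrite -ler_pdivlMr.
under eq_bigr do rewrite ffunE mulrDr mulrCA mulrBr.
rewrite big_split -mulr_sumr sumrB /=.
move: (\sum_i l i * y i) (\sum_i l i * p i) yc cp => Y P yc cp.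
rewrite leNgt => /negP; apply.
have : d * (Y - P) < 0 by rewrite pmulr_rlt0 // subr_lt0 (le_lt_trans yc).
by move: yc => {de ye}; lra.
Qed.

End ConvexHulls.

Lemma relative_interior_positive (R : realType) n m (S : set {ffun 'I_n -> R})
    (p : 'I_m -> {ffun 'I_n -> R}) (c : 'I_m -> R) (s : R) :
  s != 0 -> (forall q, S q <-> exists k, q = p k) ->
  (forall k, \sum_i p k i = s) -> (forall k, 0 < c k) -> \sum_k c k = 1 ->
  relative_interior (convex_hull S) [ffun i => \sum_k c k * p k i].
Proof.
move=> s0 Sp ps c0 c1; set x := finfun _.
split; first by exists m, c, p; split=> // k; [apply/Sp; exists k|exact: ltW].
pose M : 'M[R]_(m, n) := \matrix_(k, i) p k i.
pose Q := pinvmx M.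
have [k|e e0 ec] := @exists_lower_bound R _ (fun k => c k / (1 + \sum_i `|Q i k|)).
  by rewrite divr_gt0 // ltr_pwDl // sumr_ge0.
exists e => // y Ay yx.
pose rv (q : {ffun 'I_n -> R}) : 'rV[R]_n := \row_i q i.
have comb l (d : 'I_l -> R) (q : 'I_l -> {ffun 'I_n -> R}) :
    (forall k, (rv (q k) <= M)%MS) ->
      (rv [ffun i => (\sum_k d k * q k i)%R] <= M)%MS.
  move=> qM; have -> : rv [ffun i => \sum_k d k * q k i] = \sum_k d k *: rv (q k).
    apply/rowP => i; rewrite mxE ffunE summxE; apply: eq_bigr => k _.
    by rewrite !mxE.
  by apply: summx_sub => k _; exact: scalemx_sub.
have SM q : S q -> (rv q <= M)%MS.
  move=> /Sp[k ->]; have -> : rv (p k) = row k M by apply/rowP => i;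
    rewrite !mxE.
  exact: row_sub.
have CM q : convex_hull S q -> (rv q <= M)%MS.
  by move=> [l [d [r [Sr _ _ ->]]]]; apply: comb => k; exact: SM.
have xS : convex_hull S x.
  by exists m, c, p; split=> // k; [apply/Sp; exists k|exact: ltW].
have yM : (rv y <= M)%MS.
  by move: Ay => [l [d [r [Sr _ ->]]]]; apply: comb => k; exact: CM.
have one (q : {ffun 'I_n -> R}) : \sum_i 1 * q i = \sum_i q i.
  by under eq_bigr do rewrite mul1r.
have Cs q : convex_hull S q -> \sum_i 1 * q i = s.
  move=> [l [d [r [Sr _ d1 qE]]]]; apply: (@affine_hull_eq _ _ S).
    by move=> _ /Sp[k ->]; rewrite one.
  by exists l, d, r.
pose D := (rv y - rv x) *m Q.
have DM : D *m M = rv y - rv x.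
  apply: mulmxKpV; apply: addmx_sub yM _; rewrite eqmx_opp; exact: CM xS.
have DE i : \sum_k D 0 k * p k i = y i - x i.
  transitivity ((D *m M) 0 i); last by rewrite DM !mxE.
  by rewrite [RHS]mxE; apply: eq_bigr => k _; rewrite [M k i]mxE.
have D0 : \sum_k D 0 k = 0.
  apply: (mulIf s0); rewrite mul0r mulr_suml.
  transitivity (\sum_k \sum_i D 0 k * p k i).
    by apply: eq_bigr => k _; rewrite -mulr_sumr ps.
  rewrite exchange_big /=; under eq_bigr do rewrite DE.
  rewrite sumrB; apply/eqP; rewrite subr_eq0; apply/eqP.
  by rewrite -one (affine_hull_eq Cs Ay) -(Cs _ xS) one.
have Dc k : `|D 0 k| <= c k.
  have n0 : 0 < 1 + \sum_i `|Q i k| by rewrite ltr_pwDl // sumr_ge0.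
  apply: le_trans (_ : e * (1 + \sum_i `|Q i k|) <= _); last first.
    by rewrite -ler_pdivlMr.
  apply: le_trans (_ : e * \sum_i `|Q i k| <= _);
    last by rewrite ler_pM2l // lerDr.
  rewrite mxE mulr_sumr; apply: le_trans (ler_norm_sum _ _ _) _.
  apply: ler_sum => i _; rewrite normrM ler_wpM2r // !mxE; exact/ltW/yx.
exists m, (fun k => c k + D 0 k), p; split=> [k|k||].
- by apply/Sp; exists k.
- by rewrite -lerBlDr sub0r; apply: le_trans (Dc k); rewrite -normrN ler_norm.
- by rewrite big_split /= c1 D0 addr0.
apply/ffunP => i; rewrite ffunE; under eq_bigr do rewrite mulrDl.
rewrite big_split /= DE; have -> : \sum_k c k * p k i = x i by rewrite ffunE.
by rewrite addrC subrK.
Qed.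

Section Chamber.
Variables (R : realType) (N : nat).
Hypothesis N0 : (0 < N)%N.
Local Notation C := R[i].
Local Notation col0 := (col0 N).
Local Notation col1 := (col1 N).
Local Notation omega := (omega R N).
Implicit Types (I : {set 'I_N.+2}) (s : {set {set 'I_N.+2}}).

Definition vertices s : set {ffun 'I_N.+2 -> R} :=
  [set indicator R I | I in [set I | I \in s]].

Lemma cards2_eq I (i j : 'I_N.+2) : #|I| = 2%N -> i \in I -> j \in I ->
  i != j ->
  I = [set i; j]%SET.
Proof.
move=> I2 iI jI ij; apply/esym/eqP; rewrite eqEcard cards2 ij I2 leqnn andbT.
by apply/fintype.subsetP => k; rewrite !inE => /orP[]/eqP->.
Qed.

Lemma sum_indicator I : #|I| = 2%N -> \sum_i indicator R I i = 2.
Proof.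
move=> I2; rewrite -[RHS]/(2%:R) -I2 -sumr_const [RHS]big_mkcond /=.
by apply: eq_bigr => i _; rewrite ffunE; case: (i \in I).
Qed.

Lemma sum_delta (f : 'I_N.+2 -> R) j : \sum_i (i == j)%:R * f i = f j.
Proof.
rewrite (bigD1 j) //= eqxx mul1r big1 ?addr0 // => i /negPf ->.
by rewrite mul0r.
Qed.

Lemma sum_delta2 (f : 'I_N.+2 -> R) j k :
  \sum_i ((i == j)%:R + (i == k)%:R) * f i = f j + f k.
Proof.
by under eq_bigr do rewrite mulrDl; rewrite big_split /= !sum_delta.
Qed.

(* The polytope of this configuration gives the wall 1 < y col0 + y i.        *)
Definition coincident (i : 'I_N.+2) : 'M[C]_(2, N.+2) :=
  \matrix_(a, j) if j == col0 then (a == 0)%:R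
                 else if j == i then (a == 1)%:R else 1.

Lemma coincident_plucker0 i j : i != col0 -> j != col0 ->
  plucker (coincident i) col0 j != 0.
Proof.
move=> i0 /negPf j0; rewrite pluckerE !mxE eqxx j0 /=.
by case: ifP => _;
  rewrite ?mulr0n ?mulr1n ?(mul1r, mulr0, mul0r) subr0 oner_neq0.
Qed.

Lemma coincident_plucker i j : i != col0 -> j != col0 -> j != i ->
  plucker (coincident i) i j != 0.
Proof.
move=> /negPf i0 /negPf j0 /negPf ji; rewrite pluckerE !mxE i0 j0 ji eqxx /=.
by rewrite mul0r mul1r sub0r oppr_eq0 oner_neq0.
Qed.

Lemma coincident_plucker_eq0 i j k : j != col0 -> k != col0 -> j != i ->
  k != i ->
  plucker (coincident i) j k = 0.
Proof.
move=> /negPf j0 /negPf k0 /negPf ji /negPf ki.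
by rewrite pluckerE !mxE j0 k0 ji ki subrr.
Qed.

Lemma exists_third (i : 'I_N.+2) : exists k, k != col0 /\ k != i.
Proof.
have [->|i1] := eqVneq i col1.
  exists (colS (Ordinal N0)); split=> //.
by exists col1; split=> //; rewrite eq_sym.
Qed.

Lemma coincident_omega i : i != col0 -> support (coincident i) \in omega.
Proof.
move=> i0; have [k [k0 ki]] := exists_third i; apply/in_omega; split.
- exact: admissible_support (coincident_plucker0 i0 i0).
- by move=> j j0; rewrite in_support ?coincident_plucker0 // eq_sym.
have ik : i != k by rewrite eq_sym.
by exists i, k; split=> //; rewrite in_support // coincident_plucker.
Qed.

Lemma coincident_meets i I : i != col0 -> I \in support (coincident i) ->
  (col0 \in I) || (i \in I).
Proof.
move=> i0; rewrite inE => /andP[/eqP I2 /forall_inP h].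
apply: contraT; rewrite negb_or => /andP[nI0 nIi].
have /card_gt1P[j [k [jI kI jk]]] : (1 < #|I|)%N by rewrite I2.
have /forall_inP/(_ k kI) := h j jI.
rewrite jk coincident_plucker_eq0 ?eqxx //.
- by apply: contraNneq nI0 => <-.
- by apply: contraNneq nI0 => <-.
- by apply: contraNneq nIi => <-.
- by apply: contraNneq nIi => <-.
Qed.

Lemma admissible_card s I : admissible R s -> I \in s -> #|I| = 2%N.
Proof. by case=> h _; exact: h. Qed.

Lemma omega_admissible s : s \in omega -> admissible R s.
Proof. by move/in_omega => []. Qed.

Section ChamberPoint.
Variable y : {ffun 'I_N.+2 -> R}.
Hypothesis yC : chamber_set omega y.

Let y_relint s : s \in omega -> relative_interior (convex_hull (vertices s)) y.
Proof. exact: yC. Qed.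

Lemma chamber_gt s I (l : 'I_N.+2 -> R) c : s \in omega -> I \in s ->
  (forall J, J \in s -> c <= \sum_i l i * indicator R J i) ->
  c < \sum_i l i * indicator R I i -> c < \sum_i l i * y i.
Proof.
move=> so sI sc cI.
apply: (relative_interior_gt _ _ cI (y_relint so)); last by exists I.
by move=> _ [J sJ <-]; exact: sc.
Qed.

Lemma chamber_gt0 j : 0 < y j.
Proof.
have c10 : col1 != col0 by [].
have so := coincident_omega c10; have [_ s0 _] := (in_omega _ _).1 so.
have [I sI jI] : exists2 I, I \in support (coincident col1) & j \in I.
  have [->|j0] := eqVneq j col0.
    by exists [set col0; col1]%SET; [exact: s0|rewrite set21].
  by exists [set col0; j]%SET; [exact: s0|rewrite set22].
have := @chamber_gt _ I (fun i => (i == j)%:R) 0 so sI.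
rewrite !sum_delta; apply=> [J _|]; rewrite ?sum_delta ffunE ?jI ?ltr01 //.
Qed.

Lemma chamber_lt1 j : y j < 1.
Proof.
have c10 : col1 != col0 by [].
have so := coincident_omega c10; have [_ s0 _] := (in_omega _ _).1 so.
have [I sI jI] : exists2 I, I \in support (coincident col1) & j \notin I.
  have [->|j0] := eqVneq j col0.
    have [k [k0 k1]] := exists_third col1.
    exists [set col1; k]%SET; last by rewrite !inE negb_or eq_sym c10 eq_sym k0.
    have k1' : col1 != k by rewrite eq_sym.
    by rewrite in_support // coincident_plucker.
  have [k [k0 kj]] := exists_third j.
  exists [set col0; k]%SET; first exact: s0.
  by rewrite !inE negb_or j0 eq_sym kj.
have := @chamber_gt _ I (fun i => - (i == j)%:R) (-1) so sI.
have e (f : 'I_N.+2 -> R) : \sum_i - (i == j)%:R * f i = - f j.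
  by under eq_bigr do rewrite mulNr; rewrite sumrN sum_delta.
rewrite !e !ltrN2 ffunE (negPf jI) ltr01; apply=> // J _.
by rewrite e ffunE lerN2; case: (j \in J).
Qed.

Lemma chamber_gt1 i : i != col0 -> 1 < y col0 + y i.
Proof.
move=> i0; have so := coincident_omega i0; have [_ s0 _] := (in_omega _ _).1 so.
have := @chamber_gt _ [set col0; i]%SET
  (fun k => (k == col0)%:R + (k == i)%:R) 1 so (s0 _ i0).
rewrite !sum_delta2 !ffunE set21 set22; apply; last by rewrite ltrDl.
move=> J sJ; rewrite sum_delta2 !ffunE.
by have := coincident_meets i0 sJ; case: (col0 \in J); case: (i \in J);
  rewrite ?addr0 ?add0r ?lerDl.
Qed.

Lemma chamber_sum : \sum_i y i = 2.
Proof.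
have c10 : col1 != col0 by [].
have so := coincident_omega c10.
have [[m [c [p [Sp _ c1 yE]]]] _] := y_relint so.
have : \sum_i 1 * y i = 2.
  apply: (@affine_hull_eq _ _ (vertices (support (coincident col1)))).
    move=> _ [I sI <-]; under eq_bigr do rewrite mul1r.
    exact: sum_indicator (admissible_card (omega_admissible so) sI).
  by exists m, c, p.
by under eq_bigr do rewrite mul1r.
Qed.

Lemma chamber_hypersimplex : relative_interior (@hypersimplex R N.+2) y.
Proof.
split.
  split; last exact: chamber_sum.
  by move=> i; rewrite !ltW ?chamber_gt0 ?chamber_lt1.
have [t|e e0 ey] := @exists_lower_bound R _ (fun i => Num.min (y i) (1 - y i)).
  by rewrite lt_min chamber_gt0 subr_gt0 chamber_lt1.
exists e => // z Az zy; split.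
  move=> i; have := zy i; have := ey i; rewrite le_min => /andP[].
  rewrite ltr_norml => ? ? /andP[? ?]; apply/andP; split; lra.
have <- : \sum_i 1 * z i = \sum_i z i by under eq_bigr do rewrite mul1r.
apply: affine_hull_eq Az => p [_ <-].
by under eq_bigr do rewrite mul1r.
Qed.

Lemma chamber_outside s : admissible R s -> s \notin omega ->
  ~ relative_interior (@admissible_polytope R N.+2 s) y.
Proof.
move=> ads so [ys _].
have [[i [i0 is0]]|h0] := pselect (exists i, i != col0 /\ [set col0; i]%SET \notin s).
  have : -1 <= \sum_k - ((k == col0)%:R + (k == i)%:R) * y k.
    apply: convex_hull_ge ys => _ [I sI <-].
    under eq_bigr do rewrite mulNr; rewrite sumrN sum_delta2 lerN2 !ffunE.
    have : ~~ ((col0 \in I) && (i \in I)).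
      apply: contra is0 => /andP[I0 Ii].
      rewrite -(cards2_eq (admissible_card ads sI) I0 Ii) // eq_sym //.
    by case: (col0 \in I); case: (i \in I); rewrite ?addr0 ?add0r.
  under eq_bigr do rewrite mulNr; rewrite sumrN sum_delta2 lerN2 leNgt.
  by rewrite chamber_gt1.
have : 1 <= \sum_k (k == col0)%:R * y k.
  apply: convex_hull_ge ys => _ [I sI <-]; rewrite sum_delta ffunE.
  case: (boolP (col0 \in I)) => // I0; case/negP: so; apply/in_omega;
    split=> //.
    by move=> i i0; apply: contrapT => /negP is0; apply: h0; exists i.
  have I2 := admissible_card ads sI.
  have /card_gt1P[j [k [jI kI jk]]] : (1 < #|I|)%N by rewrite I2.
  exists j, k; split=> //; last by rewrite -(cards2_eq I2 jI kI jk).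
    by apply: contraNneq I0 => <-.
  by apply: contraNneq I0 => <-.
by rewrite sum_delta leNgt chamber_lt1.
Qed.

End ChamberPoint.

Definition heavy_point : {ffun 'I_N.+2 -> R} :=
  [ffun i => if i == col0 then 1 - N.+1%:R^-1
             else (1 + N.+1%:R^-1) / N.+1%:R].

Lemma sum_not_col0 (F : 'I_N.+2 -> R) :
  \sum_i F i = F col0 + \sum_(i | i != col0) F i.
Proof. by rewrite (bigD1 col0). Qed.

Lemma sum_const_not_col0 (a : R) : \sum_(i : 'I_N.+2 | i != col0) a = N.+1%:R * a.
Proof.
have := sum_not_col0 (fun=> a); rewrite sumr_const card_ord mulrS.
by move/addrI <-; rewrite mulr_natl.
Qed.

Lemma sum_pairs_col0 s (F : {set 'I_N.+2} -> R) :
  admissible R s -> (forall i, i != col0 -> [set col0; i]%SET \in s) ->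
  \sum_(I in s | col0 \in I) F I = \sum_(i | i != col0) F [set col0; i]%SET.
Proof.
move=> ads s0; pose f (i : 'I_N.+2) := [set col0; i]%SET.
have inj : {in [pred i | i != col0] &, injective f}.
  move=> i j; rewrite !inE => i0 j0 /setP/(_ i).
  by rewrite !inE eqxx orbT (negPf i0) /= => /esym/eqP.
rewrite -(big_imset F inj); apply: eq_bigl => I.
apply/andP/imsetP => [[sI I0]|[i i0 ->]]; last by rewrite s0 // set21.
have /card_gt1P[j [k [jI kI jk]]] : (1 < #|I|)%N by rewrite (admissible_card ads sI).
have [j0|j0] := eqVneq j col0.
  exists k; first by rewrite inE -j0 eq_sym.
  by rewrite /f (cards2_eq (admissible_card ads sI) jI kI jk) j0.
exists j => //.
by rewrite /f (cards2_eq (admissible_card ads sI) I0 jI) // eq_sym.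
Qed.

Lemma heavy_point_relint s : s \in omega ->
  relative_interior (convex_hull (vertices s)) heavy_point.
Proof.
move=> so; have [ads s0 [i1 [i2 [i10 i20 i12 s12]]]] := (in_omega _ _).1 so.
pose m : R := N.+1%:R.
have m0 : 0 < m by rewrite ltr0n.
have m1 : m^-1 > 0 by rewrite invr_gt0.
pose T := \sum_(I in s | col0 \notin I) (1 : R).
have T0 : 0 < T.
  rewrite /T (bigD1 [set i1; i2]%SET) /=; last first.
    by rewrite s12 !inE negb_or ![col0 == _]eq_sym i10 i20.
  by rewrite ltr_pwDl // sumr_ge0.
pose b := m^-1 / T.
have b0 : 0 < b by rewrite divr_gt0.
pose deg i := \sum_(I in s | col0 \notin I) indicator R I i.
have degT i : deg i <= T.
  by apply: ler_sum => I _; rewrite ffunE; case: (i \in I).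
pose a i := (1 + m^-1) / m - b * deg i.
have a0 i : 0 < a i.
  have : b * deg i <= m^-1.
    apply: le_trans (_ : b * T <= _); first by rewrite ler_pM2l.
    by rewrite divfK // gt_eqF.
  have : m^-1 < (1 + m^-1) / m by rewrite ltr_pdivlMr // mulVf ?gt_eqF // ltrDl.
  by rewrite subr_gt0 => ? /le_lt_trans; apply.
pose c (I : {set 'I_N.+2}) := if col0 \in I
  then \sum_(i | i != col0) indicator R I i * a i else b.
have c0 i : i != col0 -> c [set col0; i]%SET = a i.
  move=> i0; rewrite /c set21 (bigD1 i) //= ffunE set22 mul1r big1 ?addr0 //.
  move=> j /andP[/negPf j0 /negPf ji]; by rewrite ffunE !inE j0 ji mul0r.
have sumc (F : {set 'I_N.+2} -> R) : \sum_(I in s) c I * F I =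
    \sum_(i | i != col0) a i * F [set col0; i]%SET
    + b * \sum_(I in s | col0 \notin I) F I.
  rewrite (bigID (fun I : {set 'I_N.+2} => col0 \in I)) /=; congr (_ + _).
    by rewrite sum_pairs_col0 //; apply: eq_bigr => i i0; rewrite c0.
  rewrite mulr_sumr; apply: eq_bigr => I /andP[_ /negPf I0].
  by rewrite /c I0.
have sumdeg : \sum_(i | i != col0) deg i = 2 * T.
  rewrite /deg exchange_big /= /T mulr_sumr; apply: eq_bigr => I /andP[sI I0].
  rewrite mulr1 -(sum_indicator (admissible_card ads sI)) sum_not_col0.
  by rewrite ffunE (negPf I0) add0r.
have bT : b * T = m^-1 by rewrite divfK // gt_eqF.
have suma : \sum_(i | i != col0) a i = 1 - m^-1.
  rewrite sumrB sum_const_not_col0 -mulr_sumr sumdeg [b * _]mulrCA bT.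
  have id (u : R) : u != 0 -> u * ((1 + u^-1) / u) - 2 * u^-1 = 1 - u^-1.
    by move=> u0; field.
  by rewrite -/m id ?gt_eqF.
pose p (k : 'I_#|s|) : {ffun 'I_N.+2 -> R} := indicator R (enum_val k).
have enumE (F : {set 'I_N.+2} -> R) :
    \sum_(k < #|s|) F (enum_val k) = \sum_(I in s) F I.
  by rewrite [RHS]big_enum_val.
have xE : heavy_point = [ffun i => \sum_k c (enum_val k) * p k i].
  apply/ffunP => j; rewrite !ffunE.
  rewrite (enumE (fun I : {set 'I_N.+2} => c I * indicator R I j)) sumc.
  have [->|j0] := eqVneq j col0.
    rewrite [X in b * X]big1 ?mulr0 ?addr0; last first.
      by move=> I /andP[_ /negPf I0]; rewrite ffunE I0.
    by rewrite -suma; apply: eq_bigr => i _; rewrite ffunE set21 mulr1.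
  rewrite -/(deg j) (bigD1 j) //= ffunE set22 mulr1 big1 ?addr0 ?subrK //.
  move=> i /andP[_ /negPf ij]; rewrite ffunE !inE [j == i]eq_sym ij.
  by rewrite (negPf j0) mulr0.
rewrite xE.
apply: (@relative_interior_positive _ _ _ _ p _ 2) => [|q|k|k|].
- by rewrite pnatr_eq0.
- split=> [[I sI <-]|[k ->]]; last by exists (enum_val k) => //=;
  exact: enum_valP.
  by exists (enum_rank_in sI I); rewrite /p enum_rankK_in.
- exact: sum_indicator (admissible_card ads (enum_valP k)).
- have := enum_valP k; move: (enum_val k) => I sI; rewrite /c.
  case: ifP => // I0.
  have /card_gt1P[i [j [iI jI ij]]] : (1 < #|I|)%N by rewrite (admissible_card ads sI).
  have pos l : l \in I -> l != col0 ->
    0 < \sum_(i | i != col0) indicator R I i * a i.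
    move=> lI l0; rewrite (bigD1 l) //= ffunE lI mul1r ltr_pwDl //.
    by apply: sumr_ge0 => u _; apply: mulr_ge0;
      [rewrite ffunE ler0n|exact: ltW].
  have [i0|] := eqVneq i col0; last exact: pos.
  by apply: (pos j) => //; rewrite -i0 eq_sym.
rewrite (enumE c).
under eq_bigr do rewrite -[c _]mulr1.
rewrite (sumc (fun=> 1)) -/T bT; under eq_bigr do rewrite mulr1.
by rewrite suma subrK.
Qed.

Lemma chamber_omega : chamber R omega.
Proof.
split.
- exact: omega_admissible.
- by exists heavy_point => s; exact: heavy_point_relint.
- move=> s ads so; apply/seteqP; split=> // y [yC ys].
  exact: chamber_outside yC _ ads so ys.
- by move=> y; exact: chamber_hypersimplex.
Qed.

End Chamber.

Lemma projective_chamber (R : realType) (N : nat) (G : graph) :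
  (0 < N)%N -> #|G| = N ->
  [/\ chamber R (omega R N), variety (space_of_parameters R (omega R N)) &
      exists f : graph_associahedron_toric_variety R G ->
                 space_of_parameters R (omega R N),
        birational_morphism f].
Proof.
move=> N0 GN; have G0 : (0 < #|G|)%N by rewrite GN.
have mh := @morphism_homog R N; have fh := @final_homog R N.
have h_eq := @homog_eq R N.
split; [exact: chamber_omega|exact: projective_variety mh fh h_eq N0|].
pose e (j : 'I_N) : G := enum_val (cast_ord (esym GN) j).
pose e' (v : G) : 'I_N := cast_ord GN (enum_rank v).
have eK : cancel e e' by move=> j; rewrite /e' enum_valK cast_ordKV.
have e'K : cancel e' e by move=> v; rewrite /e cast_ordK enum_rankK.
apply: (toric_birational _ _ _ eK e'K mh fh h_eq).
- exact: graph_associahedron_convex.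
- by exists (truncation_height R #|G|) => x; exact: graph_associahedron_sum.
- by move=> x; exact: graph_associahedron_dominated.
- exact: graph_associahedron_nonempty.
Qed.

Lemma card_iter_cone (G : graph) m : #|iter m cone G| = (m + #|G|)%N.
Proof. by elim: m => // m IHm; rewrite iterS card_option IHm. Qed.

Theorem corollary10 (R : realType) (n k : nat) (hk : (1 <= k)%N)
    (hn : (k + 2 <= n)%N) :
  let Gamma := iter (n - k - 2) cone (discrete_graph k) in
  exists omega : {set {set {set 'I_n}}},
    [/\ chamber R omega,
        variety (space_of_parameters R omega) &
        exists f : graph_associahedron_toric_variety R Gamma ->
                   space_of_parameters R omega,
          birational_morphism f].
Proof.
case: n hn => [|[|N]]; rewrite ?addn2 // !ltnS => kN Gamma.
have GN : #|Gamma| = N.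
  by rewrite card_iter_cone card_ord -subnDA addn2 !subSS subnK.
exists (omega R N); apply: projective_chamber GN.
exact: leq_trans hk kN.
Qed.
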